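(* Let $T$ be a complete dependent theory with monster model $\mathfrak{C}$ and let $A\subseteq\mathfrak{C}$ be a (small) set. (i) Let $I$ be a Lascar special sequence over $A$. Then for every set $C$ the type $\mathrm{Ev}(I,C)$ does not fork over $A$. (ii) Let $Q$ be a special type over $A$. Then for every set $C$ the type $\mathrm{Ev}(Q,C)$ neither splits nor forks over $A$.
   Context: Setting: $T$ is a complete theory (classical first-order, or continuous), $T=T^{eq}$, with monster model $\mathfrak{C}$. $T$ is dependent: for every indiscernible sequence $\langle a_i:i<\lambda\rangle$, every formula $\varphi(x,y)$ and every $c$, the limit $\lim_{i<\lambda}\varphi(a_i,c)$ of truth values exists (classically: the truth value is eventually constant). Conventions: all indiscernible sequences are indexed by infinite linear orders without a last element. For an indiscernible sequence $J=\langle a_i:i\in O\rangle$, $\lim_J\varphi(x,b)$ denotes the limit of the truth values $\varphi(a_i,b)$ as $i$ goes to the end of $O$. An indiscernible type $Q$ over $A$ is the Ehrenfeucht–Mostowski type over $A$ of an $A$-indiscernible sequence; $J\models Q$ means that $J$ is an $A$-indiscernible sequence, of any infinite order type without last element, with Ehrenfeucht–Mostowski type $Q$ over $A$. For $A$-indiscernible sequences $I,J$, possibly of different order types, $I\equiv_{\mathrm{lstp},A}J$ means that some (equivalently, any) increasing subsequences of order type $\omega$ of $I$ and of $J$ have the same Lascar strong type over $A$. $J$ continues $I$ over $A$ if $I^\frown J$ is $A$-indiscernible. An $A$-indiscernible sequence $I$ is special over $A$ (and $Q=\mathrm{tp}(I/A)$ is a special type over $A$) if for any two realizations $I_1,I_2$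 of $\mathrm{tp}(I/A)$ there is $c$ such that $I_1{}^\frown c$ and $I_2{}^\frown c$ are $A$-indiscernible. $I$ is Lascar special over $A$ if the same holds for any two realizations $I_1,I_2$ of $\mathrm{lstp}(I/A)$. An $A$-indiscernible sequence $J$ eventually determines $\varphi(x,b)$ if $\lim_{J'}\varphi(x,b)$ takes the same value for all $J'$ continuing $J$ over $A$. If $I$ is Lascar special over $A$, then for each formula $\varphi(x,b)$ there is $J\equiv_{\mathrm{lstp},A}I$ eventually determining $\varphi(x,b)$, and the value $\lim_J\varphi(x,b)$ does not depend on the choice of such $J$; it is called the eventual value $\varphi^I(x,b)$. For a set $C$ (possibly $C=\mathfrak{C}$), the eventual type $\mathrm{Ev}(I,C)$ is the complete type over $C$ in which each formula $\varphi(x,b)$ over $C$ has value $\varphi^I(x,b)$. If $Q$ is special over $A$, $\mathrm{Ev}(Q,C)$ is defined in the same way using all $J\models Q$ which eventually determine $\varphi(x,b)$ (the value then depends only on $Q$). A type $p$ splits over $A$ if there are $b\equiv_A b'$ in its domain and a formula $\varphi(x,y)$ over $A$ whose values at $\varphi(x,b)$ and $\varphi(x,b')$ according to $p$ differ. *)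

(* Defs.v *)
From HB Require Import structures.
From mathcomp Require Import all_boot all_order all_algebra.
From mathcomp Require Import all_classical all_reals all_analysis.

Set Implicit Arguments.
Unset Strict Implicit.
Unset Printing Implicit Defensive.

Import Order.TTheory GRing.Theory Num.Theory.
Import numFieldNormedType.Exports.

Local Open Scope classical_set_scope.
Local Open Scope card_scope.
Local Open Scope ring_scope.

(* Many-sorted tuples.  Variables and tuples are indexed by arbitrary types;
   every single formula only involves finitely many variables.  Languages are
   many-sorted, so that theories of the form T^eq are included. *)

Definition scons (S X : Type) (t : S) (s : X -> S) (v : option X) : S :=
  if v is Some x then s x else t.

Definition sapp (S X Y : Type) (s : X -> S) (r : Y -> S) (v : X + Y) : S :=
  match v with inl x => s x | inr y => r y end.

Definition sempty (S : Type) (v : void) : S := of_void S v.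

Definition tuple_in (S : Type) (car : S -> Type) (X : Type) (s : X -> S) :=
  forall x, car (s x).

Definition tcons (S : Type) (car : S -> Type) (X : Type) (t : S) (s : X -> S)
    (c : car t) (a : tuple_in car s) : tuple_in car (scons t s) :=
  fun v => match v with Some x => a x | None => c end.

Definition tapp (S : Type) (car : S -> Type) (X Y : Type)
    (s : X -> S) (r : Y -> S) (a : tuple_in car s) (b : tuple_in car r) :
    tuple_in car (sapp s r) :=
  fun v => match v with inl x => a x | inr y => b y end.

Definition tempty (S : Type) (car : S -> Type) : tuple_in car (sempty S) :=
  fun v => match v with end.

Record signature := Signature {
  sorts : Type;
  fsym : Type;
  farity : fsym -> nat;
  fdom : forall f, 'I_(farity f) -> sorts;
  fcod : fsym -> sorts;
  rsym : Type;
  rarity : rsym -> nat;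
  rdom : forall r, 'I_(rarity r) -> sorts }.
Arguments fdom {s} f _.
Arguments rdom {s} r _.

Inductive sterm (S : signature) (X : Type) (s : X -> sorts S) : sorts S -> Type :=
| TVar (x : X) : sterm s (s x)
| TApp (f : fsym S) (args : forall i, sterm s (fdom f i)) : sterm s (fcod f).

Fixpoint teval (S : signature) (car : sorts S -> Type)
    (fint : forall f, tuple_in car (fdom f) -> car (fcod f))
    (X : Type) (s : X -> sorts S) (a : tuple_in car s) t (u : sterm s t) : car t :=
  match u in sterm _ t return car t with
  | TVar x => a x
  | TApp f args => fint f (fun i => teval fint a (args i))
  end.

Section Classical.
Variable S : signature.

Inductive fo_form (X : Type) (s : X -> sorts S) : Type :=
| FoEq t (u v : sterm s t)
| FoRel (r : rsym S) (args : forall i, sterm s (rdom r i))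
| FoFalse
| FoImp (f g : fo_form s)
| FoAll t (f : fo_form (scons t s)).

Record fo_structure := FoStructure {
  fo_car : sorts S -> Type;
  fo_inhabited : forall t, inhabited (fo_car t);
  fo_fun : forall f, tuple_in fo_car (fdom f) -> fo_car (fcod f);
  fo_rel : forall r, tuple_in fo_car (rdom r) -> Prop }.

Fixpoint fo_sat (M : fo_structure) (X : Type) (s : X -> sorts S)
    (f : fo_form s) : tuple_in (fo_car M) s -> Prop :=
  match f with
  | FoEq _ u v => fun a => teval (@fo_fun M) a u = teval (@fo_fun M) a v
  | FoRel r args => fun a => fo_rel (fun i => teval (@fo_fun M) a (args i))
  | FoFalse => fun _ => False
  | FoImp f g => fun a => fo_sat f a -> fo_sat g a
  | FoAll t f => fun a => forall c : fo_car M t, fo_sat f (tcons c a)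
  end.

Definition fo_val (M : fo_structure) (X : Type) (s : X -> sorts S)
  (f : fo_form s) (a : tuple_in (fo_car M) s) : bool := `[< fo_sat f a >].

End Classical.

(* Continuous logic: complete metric structures of diameter at most 1,
   [0, 1]-valued predicates (0 is "true"), all continuous functions
   [0, 1]^n -> [0, 1] as connectives, sup and inf as quantifiers. *)
Section Continuous.
Variable R : realType.

Record metric_signature := MetricSignature {
  msig :> signature;
  fmod : fsym msig -> R -> R;
  fmod_gt0 : forall f e, 0 < e -> 0 < fmod f e;
  rmod : rsym msig -> R -> R;
  rmod_gt0 : forall r e, 0 < e -> 0 < rmod r e }.

Definition cube n : set 'rV[R]_n := [set v | forall i, 0 <= v ord0 i <= 1].
Arguments cube n : clear implicits.

Record connective n := Connective {
  conn :> 'rV[R]_n -> R;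
  conn_continuous : {within cube n, continuous conn};
  conn_range : forall v, cube n v -> 0 <= conn v <= 1 }.

Variable S : metric_signature.

Inductive ct_form (X : Type) (s : X -> sorts S) : Type :=
| CtDist t (u v : sterm s t)
| CtRel (r : rsym S) (args : forall i, sterm s (rdom r i))
| CtConn n (u : connective n) (fs : 'I_n -> ct_form s)
| CtSup t (f : ct_form (scons t s))
| CtInf t (f : ct_form (scons t s)).

Record ct_structure := CtStructure {
  ct_car : sorts S -> metricType R;
  ct_inhabited : forall t, inhabited (ct_car t);
  ct_complete : forall t (F : set_system (ct_car t)),
    ProperFilter F -> cauchy F -> exists x : ct_car t, F --> x;
  ct_diameter : forall t (x y : ct_car t), mdist x y <= 1;
  ct_fun : forall f, tuple_in ct_car (fdom f) -> ct_car (fcod f);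
  ct_fun_uc : forall f (a b : tuple_in ct_car (fdom f)) e, 0 < e ->
    (forall i, mdist (a i) (b i) < fmod f e) ->
    mdist (ct_fun a) (ct_fun b) <= e;
  ct_rel : forall r, tuple_in ct_car (rdom r) -> R;
  ct_rel_range : forall r (a : tuple_in ct_car (rdom r)), 0 <= ct_rel a <= 1;
  ct_rel_uc : forall r (a b : tuple_in ct_car (rdom r)) e, 0 < e ->
    (forall i, mdist (a i) (b i) < rmod r e) ->
    `|ct_rel a - ct_rel b| <= e }.

Fixpoint ct_val (M : ct_structure) (X : Type) (s : X -> sorts S)
    (f : ct_form s) : tuple_in (ct_car M) s -> R :=
  match f with
  | CtDist _ u v => fun a =>
      mdist (teval (@ct_fun M) a u) (teval (@ct_fun M) a v)
  | CtRel r args => fun a => ct_rel (fun i => teval (@ct_fun M) a (args i))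
  | CtConn n u fs => fun a => u (\row_i ct_val (fs i) a)
  | CtSup t f => fun a =>
      sup (range (fun c : ct_car M t => ct_val f (@tcons _ (ct_car M) _ t s c a)))
  | CtInf t f => fun a =>
      inf (range (fun c : ct_car M t => ct_val f (@tcons _ (ct_car M) _ t s c a)))
  end.

End Continuous.

(* The common interface of the two logics.  "A formula holds" means that its
   truth value is [holds]: [true] in the classical case, 0 in the continuous
   case. *)
Record logic := Logic {
  lsort : Type;
  lsymbols : Type;
  formula : forall X : Type, (X -> lsort) -> Type;
  structure : Type;
  car : structure -> lsort -> Type;
  truth : topologicalType;
  holds : truth;
  truth_of : forall (M : structure) (X : Type) (s : X -> lsort),
    formula s -> tuple_in (car M) s -> truth }.
Arguments holds {l}.

Inductive language (R : realType) :=
| Classical of signature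
| Continuous of metric_signature R.

Definition symbols (S : signature) : Type := (sorts S + fsym S + rsym S)%type.

Definition classical_logic (S : signature) : logic :=
  @Logic (sorts S) (symbols S) (@fo_form S) (fo_structure S) (@fo_car S)
    bool true (@fo_val S).

Definition continuous_logic (R : realType) (S : metric_signature R) : logic :=
  @Logic (sorts S) (symbols S) (@ct_form R S) (ct_structure S)
    (fun M t => ct_car M t) R (0 : R) (@ct_val R S).

Definition logic_of (R : realType) (L : language R) : logic :=
  match L with
  | Classical Sg => classical_logic Sg
  | Continuous Sg => continuous_logic Sg
  end.
Coercion logic_of : language >-> logic.

Section Theories.
Variable L : logic.

Definition theory := set (formula (sempty (lsort L))).

Definition models (M : structure L) (T : theory) :=
  forall f, T f -> truth_of f (tempty (car M)) = holds.

Definition complete_theory (T : theory) :=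
  (exists M, models M T) /\
  forall M N, models M T -> models N T ->
    forall f : formula (sempty (lsort L)),
      truth_of f (tempty (car M)) = truth_of f (tempty (car N)).

End Theories.

(* Cardinal [kappa] is represented by a type K of that cardinality; "small"
   means "of cardinality < kappa". *)
Definition small (K T : Type) (B : set T) := ~ ([set: K] #<= B).

Definition strong_limit (K : Type) :=
  small K [set: nat] /\
  forall X : Type, small K [set: X] -> small K [set: set X].

Section Model.
Variables (L : logic) (M : structure L).

Notation tup s := (tuple_in (car M) s).

Definition elt := {t : lsort L & car M t}.

Definition inside (C : set elt) (X : Type) (s : X -> lsort L) (a : tup s) :=
  forall x, C (existT _ (s x) (a x)).

(* The tuple enumerating a set of parameters. *)
Definition sset (A : set elt) (c : A) : lsort L := projT1 (set_val c).
Definition tset (A : set elt) : tup (@sset A) := fun c => projT2 (set_val c).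
Arguments sset A c : clear implicits.
Arguments tset A x : clear implicits.

Definition eqtp (A : set elt) (X : Type) (s : X -> lsort L) (a b : tup s) :=
  forall f : formula (sapp s (sset A)),
    truth_of f (tapp a (tset A)) = truth_of f (tapp b (tset A)).

Definition automorphism (g : forall t, car M t -> car M t) :=
  (forall t, bijective (g t)) /\
  forall (X : Type) (s : X -> lsort L) (f : formula s) (a : tup s),
    truth_of f (fun x => g _ (a x)) = truth_of f a.

Definition automorphism_over (A : set elt) (g : forall t, car M t -> car M t) :=
  automorphism g /\ forall c : elt, A c -> g _ (projT2 c) = projT2 c.

(* Formulas f(x, b) in the variables x (of sorts s) with parameters b. *)
Record pform (X : Type) (s : X -> lsort L) := PForm {
  par : nat;
  psort : 'I_par -> lsort L;
  body : formula (sapp s psort);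
  args : tup psort }.
Arguments psort {X s} p _.
Arguments args {X s} p _.

Definition pval (X : Type) (s : X -> lsort L) (f : pform s) (a : tup s) :
  truth L := truth_of (body f) (tapp a (args f)).

Definition params_in (C : set elt) (X : Type) (s : X -> lsort L) (f : pform s) :=
  inside C (args f).

Definition saturated (K : Type) :=
  forall (X : Type) (s : X -> lsort L) (A : set elt) (G : set (pform s)),
    small K [set: X] -> small K A -> (forall f, G f -> params_in A f) ->
    (forall n (f : 'I_n -> pform s), (forall i, G (f i)) ->
       exists a, forall i, pval (f i) a = holds) ->
    exists a, forall f, G f -> pval f a = holds.

Definition strongly_homogeneous (K : Type) :=
  forall (X : Type) (s : X -> lsort L) (a b : tup s),
    small K [set: X] -> eqtp set0 a b ->
    exists2 g, automorphism g & forall x, g _ (a x) = b x.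

Definition monster (K : Type) :=
  [/\ strong_limit K, small K [set: lsymbols L],
      saturated K & strongly_homogeneous K].

Definition flat (O X : Type) (s : X -> lsort L) (a : O -> tup s) :
  tup (fun p : O * X => s p.2) := fun p => a p.1 p.2.

(* Indiscernibility over A of a family indexed by a type O with a strict
   order lt. *)
Definition indiscernible (A : set elt) (O : Type) (lt : O -> O -> Prop)
    (X : Type) (s : X -> lsort L) (a : O -> tup s) :=
  forall n (i j : 'I_n -> O),
    (forall k l : 'I_n, (k < l)%N -> lt (i k) (i l)) ->
    (forall k l : 'I_n, (k < l)%N -> lt (j k) (j l)) ->
    eqtp A (flat (fun k => a (i k))) (flat (fun k => a (j k))).

Definition lt_cat (O P : Type) (lt1 : O -> O -> Prop) (lt2 : P -> P -> Prop)
    (x y : O + P) : Prop :=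
  match x, y with
  | inl i, inl j => lt1 i j
  | inl _, inr _ => True
  | inr _, inl _ => False
  | inr i, inr j => lt2 i j
  end.

Definition seq_cat (O P : Type) (X : Type) (s : X -> lsort L)
    (a : O -> tup s) (b : P -> tup s) (x : O + P) : tup s :=
  match x with inl i => a i | inr j => b j end.

Variable K : Type.

(* Sequences indexed by small nonempty linear orders without last element. *)
Record eseq (X : Type) (s : X -> lsort L) := ESeq {
  odisp : Order.disp_t;
  idx : orderType odisp;
  idx_small : small K [set: idx];
  idx_inhabited : inhabited idx;
  idx_endless : forall i : idx, exists j : idx, (i < j)%O;
  at_idx :> idx -> tup s }.

Section Sequences.
Variables (X : Type) (s : X -> lsort L).

Definition idx_lt (J : eseq s) (i j : idx J) : Prop := (i < j)%O.

Definition indisc (A : set elt) (J : eseq s) :=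
  indiscernible A (@idx_lt J) J.

Definition seq_end (J : eseq s) : set_system (idx J) :=
  [set P | exists i : idx J, forall j, (i <= j)%O -> P j].

Arguments seq_end J P : clear implicits.

Definition is_lim (J : eseq s) (f : pform s) (v : truth L) :=
  (fun i => pval f (J i)) @ seq_end J --> v.

(* J continues I over A. *)
Definition continues (A : set elt) (I J : eseq s) :=
  indiscernible A (lt_cat (@idx_lt I) (@idx_lt J)) (seq_cat I J).

Definition eventually_determines (A : set elt) (J : eseq s) (f : pform s) :=
  exists v, forall J', continues A J J' -> is_lim J' f v.

End Sequences.

Definition dependent :=
  forall (X : Type) (s : X -> lsort L) (J : eseq s) (f : pform s),
    small K [set: X] -> indisc set0 J -> exists v, is_lim J f v.

(* Lascar strong type: the finest bounded equivalence relation invariant under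
   the automorphisms fixing A pointwise. *)
Definition bounded_rel (X : Type) (s : X -> lsort L) (E : tup s -> tup s -> Prop) :=
  ~ exists a : K -> tup s, forall k l, k <> l -> ~ E (a k) (a l).

Definition invariant_rel (A : set elt) (X : Type) (s : X -> lsort L)
    (E : tup s -> tup s -> Prop) :=
  forall g, automorphism_over A g -> forall a b : tup s,
    E a b -> E (fun x => g _ (a x)) (fun x => g _ (b x)).

Definition equiv_rel (T : Type) (E : T -> T -> Prop) :=
  [/\ forall a, E a a, forall a b, E a b -> E b a &
      forall a b c, E a b -> E b c -> E a c].

Definition eqlstp (A : set elt) (X : Type) (s : X -> lsort L) (a b : tup s) :=
  forall E : tup s -> tup s -> Prop,
    equiv_rel E -> invariant_rel A E -> bounded_rel E -> E a b.

Section Types.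
Variables (X : Type) (s : X -> lsort L).

Definition eqlstp_seq (A : set elt) (I J : eseq s) :=
  exists (u : nat -> idx I) (v : nat -> idx J),
    [/\ forall m n, (m < n)%N -> (u m < u n)%O,
        forall m n, (m < n)%N -> (v m < v n)%O &
        eqlstp A (flat (fun n => I (u n))) (flat (fun n => J (v n)))].

Definition indisc_snoc (A : set elt) (I : eseq s) (a : idx I -> tup s)
    (c : tup s) :=
  indiscernible A (lt_cat (@idx_lt _ _ I) (fun _ _ : unit => False))
    (seq_cat a (fun _ : unit => c)).

Definition special (A : set elt) (I : eseq s) :=
  indisc A I /\
  forall a1 a2 : idx I -> tup s,
    eqtp A (flat a1) (flat I) -> eqtp A (flat a2) (flat I) ->
    exists c, indisc_snoc A a1 c /\ indisc_snoc A a2 c.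

Definition lascar_special (A : set elt) (I : eseq s) :=
  indisc A I /\
  forall a1 a2 : idx I -> tup s,
    eqlstp A (flat a1) (flat I) -> eqlstp A (flat a2) (flat I) ->
    exists c, indisc_snoc A a1 c /\ indisc_snoc A a2 c.

(* Ehrenfeucht-Mostowski types: the truth values, on increasing n-tuples, of
   the formulas over A. *)
Definition emtype (A : set elt) :=
  forall n, formula (sapp (fun p : 'I_n * X => s p.2) (sset A)) -> truth L.

Definition realizes_em (A : set elt) (J : eseq s) (Q : emtype A) :=
  indisc A J /\
  forall n (i : 'I_n -> idx J), (forall k l : 'I_n, (k < l)%N -> (i k < i l)%O) ->
    forall f, truth_of f (tapp (flat (fun k => J (i k))) (tset A)) = Q n f.

Definition special_type (A : set elt) (Q : emtype A) :=
  exists2 I : eseq s, realizes_em I Q & special A I.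

(* A type over C assigns a truth value to each formula over C; it is a complete
   type when each finite part of it is realized in the monster model. *)
Definition form_over (C : set elt) := {f : pform s | params_in C f}.

Definition complete_type (C : set elt) (p : form_over C -> truth L) :=
  forall n (f : 'I_n -> form_over C),
    exists a : tup s, forall i, pval (sval (f i)) a = p (f i).

(* When several values are eligible (or none), [xget] chooses one; under the
   hypotheses of the theorem there is exactly one. *)
Definition ev_lascar (A : set elt) (I : eseq s) (C : set elt)
    (f : form_over C) : truth L :=
  xget holds [set v | exists J : eseq s,
    [/\ eqlstp_seq A J I, indisc A J,
        eventually_determines A J (sval f) & is_lim J (sval f) v]].

Definition ev_type (A : set elt) (Q : emtype A) (C : set elt)
    (f : form_over C) : truth L :=
  xget holds [set v | exists J : eseq s,
    [/\ realizes_em J Q,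
        eventually_determines A J (sval f) & is_lim J (sval f) v]].

Definition divides (A : set elt) (f : pform s) :=
  exists b : nat -> tup (psort f),
    [/\ b 0%N = args f, indiscernible A (fun m n : nat => (m < n)%N) b &
        ~ exists a : tup s, forall n, truth_of (body f) (tapp a (b n)) = holds].

(* p forks over A if it implies a finite disjunction of formulas each of which
   divides over A.  Since C need not be small, the implication is witnessed, in
   the monster model, by the restriction of p to a small subset of C. *)
Definition forks (A C : set elt) (p : form_over C -> truth L) :=
  exists (C0 : set elt) n (f : 'I_n -> pform s),
    [/\ C0 `<=` C, small K C0, forall i, divides A (f i) &
        forall a : tup s,
          (forall g : form_over C, params_in C0 (sval g) -> pval (sval g) a = p g) ->
          exists i, pval (f i) a = holds].

(* The formula f(x, y, c) is over A; c also lies in C because p only evaluates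
   formulas over C. *)
Definition splits (A C : set elt) (p : form_over C -> truth L) :=
  exists (m n : nat) (r : 'I_m -> lsort L) (q : 'I_n -> lsort L)
         (f : formula (sapp s (fun i : 'I_(m + n) => sapp r q (fintype.split i))))
         (b b' : tup r) (c : tup q)
         (Cb : params_in C (PForm f (fun i => tapp b c (fintype.split i))))
         (Cb' : params_in C (PForm f (fun i => tapp b' c (fintype.split i)))),
    [/\ inside A c, eqtp A b b' & p (exist _ _ Cb) <> p (exist _ _ Cb')].

End Types.

End Model.

Arguments ev_lascar {L M K X s} A I C f.
Arguments ev_type {L M} K {X s A} Q C f.
Arguments sset {L M} A c.
Arguments tset {L M} A x.
Arguments psort {L M X s} p _.
Arguments args {L M X s} p _.
Arguments seq_end {L M K X s} J P.

(* Main.v *)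
(* Let JJ be the class of the sequences realizing Q, respectively of those with the
   Lascar strong type of I.  By dependence every sequence has a continuation which
   determines a given formula f, so every f gets an eventual value; two determining
   sequences of JJ have a common one-element continuation, obtained by compactness
   from (Lascar) speciality, so the value is unique.  Finitely many formulas are
   determined by one sequence of JJ, whose continuations realize their values;
   hence the eventual type is complete.

   JJ, and thus the eventual type, is invariant under the automorphisms over A which
   preserve Lascar strong types (under all automorphisms over A in the case of Q,
   whence no splitting).  These are transitive on each A-indiscernible sequence: a
   bounded invariant equivalence relation relates the elements of such a sequence,
   since one can prolong it beyond the number of classes, and their orbit relation
   is bounded, since two tuples of the same type over a small Skolem hull N of A
   start sequences indiscernible over N which coincide after the first element.  So
   if the eventual type contains a formula dividing over A, then it contains all
   its instances along the indiscernible sequence witnessing this, although they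
   are inconsistent. *)
Require Import Defs.
From HB Require Import structures.
From mathcomp Require Import all_boot all_order all_algebra.
From mathcomp Require Import all_classical all_reals all_analysis.
From mathcomp Require Import wochoice lra.

Set Implicit Arguments.
Unset Strict Implicit.
Unset Printing Implicit Defensive.

Import Order.TTheory GRing.Theory Num.Theory.
Import numFieldNormedType.Exports.

Local Open Scope classical_set_scope.
Local Open Scope card_scope.
Local Open Scope ring_scope.

(** * Small cardinals *)

(** Two constraints shape the proof. Truth values may be real numbers, so that equalities are
    reached through estimates; [tame] collects what both logics share, above all that closeness to a
    given value is itself the holding of a formula. And [K] is only a strong limit: no partition
    theorem is used, the indiscernible sequences needed come from coheirs over a Skolem hull, and
    every cardinal bound is obtained by an injective coding, formulas and Skolem terms becoming
    labelled trees. The definition of eventual values asks only for determined limits. The proof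
    works with a stronger requirement, that every element of a continuation already has the value.
    Then one element realizes finitely many eventual values exactly, even in continuous logic, and
    one common element is enough to compare two sequences. *)

Definition embeds (X Y : Type) := exists f : X -> Y, injective f.

Lemma embeds_trans (X Y Z : Type) : embeds X Y -> embeds Y Z -> embeds X Z.
Proof. by move=> [f fI] [g gI]; exists (g \o f); exact: inj_comp. Qed.

Lemma card_le_embeds (T U : Type) (A : set T) (B : set U) :
  A #<= B <-> embeds A B.
Proof.
split=> [/card_leP[f]|[f fI]].
  by exists f => x y /(@inj _ _ _ f) -> //; rewrite inE.
by apply/card_leP/injfunPex; exists f => // x y _ _ /fI.
Qed.

Lemma smallE (K T : Type) (A : set T) : small K A <-> ~ embeds K A.
Proof.
split=> sA h; apply: sA.
  apply/card_le_embeds; apply: embeds_trans h.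
  by exists sval => -[x ?] [y ?] /= ?; apply: eq_exist.
move/card_le_embeds: h; apply: embeds_trans.
by exists (fun x => exist _ x (mem_set I)) => x y [].
Qed.

Lemma smallTE (K X : Type) : small K [set: X] <-> ~ embeds K X.
Proof.
rewrite smallE; split=> sA h; apply: sA; apply: embeds_trans h _.
  by exists (fun x => exist _ x (mem_set I)) => x y [].
by exists sval => -[x ?] [y ?] /= ?; apply: eq_exist.
Qed.

Lemma small_embeds (K X Y : Type) : embeds X Y ->
  small K [set: Y] -> small K [set: X].
Proof.
by rewrite !smallTE => XY nY KX; apply: nY; apply: embeds_trans XY.
Qed.

Lemma small_inj (K X Y : Type) (f : X -> Y) : injective f ->
  small K [set: Y] -> small K [set: X].
Proof. by move=> fI; apply: small_embeds; exists f. Qed.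

Lemma small_set (K T : Type) (A : set T) : small K A <-> small K [set: A].
Proof. by rewrite smallE smallTE. Qed.

(** Zorn's lemma for graphs of partial injections: a maximal graph is total on one of the two sides,
    otherwise a pair of missed points could be added. *)
Lemma embeds_total (X Y : Type) : embeds X Y \/ embeds Y X.
Proof.
pose P : set (set (X * Y)) := [set G | forall p q, G p -> G q -> p.1 = q.1 <-> p.2 = q.2].
have [|G [PG Gmax]] := @Zorn_bigcup _ P.
  move=> F FP Ftot p q [G FG Gp] [H FH Hq].
  have [GH|HG] := Ftot _ _ FG FH; first by apply: (FP _ FH) => //; exact: GH.
  by apply: (FP _ FG) => //; exact: HG.
have [tot|/existsNP[x nx]] := pselect (forall x, exists y, G (x, y)).
  left; have [f Gf] := choice tot; exists f => x x' e.
  by have /= := PG _ _ (Gf x) (Gf x'); rewrite e => -[_ ->].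
have [tot|/existsNP[y ny]] := pselect (forall y, exists x, G (x, y)).
  right; have [f Gf] := choice tot; exists f => y y' e.
  by have /= := PG _ _ (Gf y) (Gf y'); rewrite e => -[/(_ erefl) -> _].
exfalso; apply: (Gmax (G `|` [set (x, y)])).
  split; first by move=> p; left.
  by move=> /(_ (x, y)) h; apply: nx; exists y; apply: h; right.
move=> p q [Gp|->] [Gq|->] /=; first exact: PG.
- by split=> e; exfalso; [apply: nx; exists p.2|apply: ny; exists p.1];
    rewrite -e -surjective_pairing.
- by split=> e; exfalso; [apply: nx; exists q.2|apply: ny; exists q.1];
    rewrite e -surjective_pairing.
- by [].
Qed.

Lemma no_embeds_powerset (X : Type) : ~ embeds (set X) X.
Proof.
move=> [f fI]; pose D : set X := [set x | exists2 A, f A = x & ~ A x].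
have nD : ~ D (f D) by move=> /[dup] DD [A /fI eA]; rewrite eA.
by apply: (nD); exists D.
Qed.

Section SmallTypes.
Variables (K : Type) (K_lim : strong_limit K).

Lemma small_nat : small K [set: nat].
Proof. by have [] := K_lim. Qed.

Lemma small_powerset (X : Type) : small K [set: X] -> small K [set: set X].
Proof. by have [_] := K_lim; apply. Qed.

Lemma small_pair_common (X Y : Type) : small K [set: X] -> small K [set: Y] ->
  exists Z, [/\ small K [set: Z], embeds X Z, embeds Y Z & embeds nat Z].
Proof.
have common U V : small K [set: U] -> small K [set: V] ->
    exists Z, [/\ small K [set: Z], embeds U Z & embeds V Z].
  have e U' : embeds U' U' by exists id.
  by move=> sU sV; have [h|h] := embeds_total U V; [exists V|exists U].
move=> sX sY; have [Z [sZ XZ YZ]] := common _ _ sX sY.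
have [W [sW ZW NW]] := common _ _ sZ small_nat.
by exists W; split=> //; [exact: embeds_trans ZW|exact: embeds_trans ZW].
Qed.

(** Kuratowski pairs over a common bound [Z] embed the product into a double power set, so that
    being a strong limit is all that is asked of [K]. *)
Lemma small_prod (X Y : Type) : small K [set: X] -> small K [set: Y] ->
  small K [set: X * Y].
Proof.
move=> sX sY; have [Z [sZ [f fI] [g gI] _]] := small_pair_common sX sY.
apply: (@small_inj _ _ _ (fun p : X * Y => [set [set f p.1]; [set f p.1; g p.2]])).
  move=> [x y] [x' y'] /= /seteqP[h h'].
  have exx : x = x'.
    have [e|e] : [set [set f x']; [set f x'; g y']] [set f x] by apply: h; left.
      by apply: fI; have : [set f x'] (f x) by rewrite -e.
    by apply: fI; have : [set f x] (f x') by rewrite e; left.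
  subst x'; congr (_, _); apply: gI.
  have gg z z' : [set [set f x]; [set f x; z]] `<=`
      [set [set f x]; [set f x; z']] -> z = z' \/ z = f x.
    move=> /(_ [set f x; z]) /(_ (or_intror erefl)) [e|e].
      by right; have : [set f x] z by rewrite -e; right.
    by have : [set f x; z'] z by [rewrite -e; right]; move=> [->|->]; [right|left].
  by have [//|e1] := gg _ _ h; have [//|e2] := gg _ _ h'; rewrite e1 e2.
exact/small_powerset/small_powerset.
Qed.

Lemma small_sum (X Y : Type) : small K [set: X] -> small K [set: Y] ->
  small K [set: X + Y].
Proof.
move=> sX sY; have [Z [sZ [f fI] [g gI] [h hI]]] := small_pair_common sX sY.
apply: (@small_inj _ _ _
    (fun p : X + Y => match p with inl x => (f x, h 0%N) | inr y => (g y, h 1%N) end)).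
  by move=> [x|y] [x'|y'] [] => [/fI ->|_ /hI|_ /hI|/gI ->].
exact: small_prod.
Qed.

Lemma small_fun (X Y : Type) : small K [set: X] -> small K [set: Y] ->
  small K [set: X -> Y].
Proof.
move=> sX sY; apply: (@small_inj _ _ _ (fun f : X -> Y => [set p : X * Y | f p.1 = p.2])).
  move=> f g e; apply/funext => x.
  by have : [set p : X * Y | f p.1 = p.2] (x, f x) by []; rewrite e /= => ->.
exact/small_powerset/small_prod.
Qed.

Lemma small_option (X : Type) : small K [set: X] -> small K [set: option X].
Proof.
move=> sX; apply: (@small_inj _ _ _
  (fun o : option X => if o is Some x then inl x else inr 0%N)).
  by move=> [x|] [y|] // [->].
exact: small_sum sX small_nat.
Qed.

Lemma small_seq (X : Type) : small K [set: X] -> small K [set: seq X].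
Proof.
move=> sX; apply: (@small_inj _ _ _ (fun (l : seq X) n => onth l n)).
  elim=> [|x l IH] [|y m] // e; have := congr1 (fun f => f 0%N) e => //=.
  by move=> [->]; congr (_ :: _); apply: IH; apply/funext => n;
    have := congr1 (fun f => f n.+1) e.
exact: small_fun small_nat (small_option sX).
Qed.

Lemma small_sigT (Z W : Type) (F : Z -> Type) (e : forall z, F z -> W) :
  small K [set: Z] -> small K [set: W] -> (forall z, injective (e z)) ->
  small K [set: {z & F z}].
Proof.
move=> sZ sW eI; apply: (@small_inj _ _ _ (fun p : {z & F z} => (projT1 p, e _ (projT2 p)))).
  by move=> [z u] [z' u'] /= [ez]; subst z' => /eI ->.
exact: small_prod.
Qed.

(** Dedekind cuts embed the reals into the power set of the rationals. *)
Lemma small_real (R : realType) : small K [set: R].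
Proof.
apply: (@small_inj _ _ _ (fun (x : R) => [set q : rat | ratr q < x])).
  have lt_neq (x y : R) : x < y ->
      [set q : rat | ratr q < x] <> [set q : rat | ratr q < y].
    move=> xy e; have [q] := rat_in_itvoo xy.
    rewrite in_itv /= => /andP[xq qy].
    have : [set q : rat | ratr q < y] q by [].
    by rewrite -e /= => /(lt_trans xq); rewrite ltxx.
  by move=> x y e; have [/lt_neq/(_ e)|/lt_neq/(_ (esym e))|] := ltgtP x y.
apply: small_powerset; apply: (small_inj (pcan_inj (@pickleK rat))).
exact: small_nat.
Qed.

End SmallTypes.

(** One shape of code for formulas and Skolem terms alike. Finitely many arguments are put on the
    first branches of a node and the other branches are padded. *)
Inductive wtree (Lb : Type) :=
| WLeaf
| WNode (l : Lb) (c : nat -> wtree Lb).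
Arguments WLeaf {Lb}.

(* A tree is determined by the labels found along its finite paths. *)
Fixpoint wlabel (Lb : Type) (t : wtree Lb) (p : seq nat) : option Lb :=
  match t, p with
  | WLeaf, _ => None
  | WNode l _, [::] => Some l
  | WNode _ c, n :: q => wlabel (c n) q
  end.

Lemma wlabel_inj (Lb : Type) : injective (@wlabel Lb).
Proof.
elim=> [|l c IH] [|l' c'] e //.
- by have := congr1 (fun f => f [::]) e.
- by have := congr1 (fun f => f [::]) e.
- have [->] := congr1 (fun f => f [::]) e; congr WNode; apply/funext => n.
  by apply: IH; apply/funext => p; have := congr1 (fun f => f (n :: p)) e.
Qed.

Lemma small_wtree (K Lb : Type) : strong_limit K -> small K [set: Lb] ->
  small K [set: wtree Lb].
Proof.
move=> Kl sL; apply: (small_inj (@wlabel_inj Lb)).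
by apply: small_fun => //; [apply: small_seq => //; exact: small_nat|exact: small_option].
Qed.

(** A well-ordering is at hand; only its strict linear part is kept, to index indiscernible
    sequences by an arbitrary small type. *)
Lemma linear_order_exists (T : Type) : exists lt : T -> T -> Prop,
  [/\ forall x, ~ lt x x, forall x y z, lt x y -> lt y z -> lt x z &
      forall x y, [\/ lt x y, x = y | lt y x]].
Proof.
have [R wR] := @well_ordering_principle {classic T}.
have wchain : wo_chain R (predT : {pred {classic T}}) by move=> A _; exact: wR.
have Rtot := wo_chainW wchain.
have Ranti := wo_chain_antisymmetric wchain.
have Rtr (x y z : {classic T}) : R x y -> R y z -> R x z.
  move=> xy yz; have [|w [[+ wlb] _]] := wR (mem [:: x; y; z]).
    by exists x; rewrite inE eqxx.
  have [wx [wy wz]] : R w x /\ R w y /\ R w z.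
    by split; [|split]; apply: wlb; rewrite !inE eqxx ?orbT.
  rewrite !inE => /or3P[/eqP e|/eqP e|/eqP e]; subst w => //.
    by rewrite (Ranti x y) ?xy.
  by rewrite -(Ranti y z) ?yz.
exists (fun x y => R x y /\ x <> y); split.
- by move=> x [].
- move=> x y z [xy nxy] [yz nyz]; split; first exact: Rtr yz.
  by move=> e; subst z; apply: nxy; apply: Ranti => //; rewrite xy yz.
- move=> x y; have [->|nxy] := pselect (x = y); first by constructor 2.
  have /orP[xy|yx] := Rtot x y isT isT; first by constructor 1.
  by constructor 3; split=> // e; apply: nxy.
Qed.

(** A name of its own for the sum type, to carry the order of a concatenation; it indexes
    [cat_seq]. *)
Definition ocat (O P : Type) : Type := (O + P)%type.
Fact ocat_display : Order.disp_t. Proof. exact: Order.Disp tt tt. Qed.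

Section OrderedSum.
Context (d e : Order.disp_t) (O : orderType d) (P : orderType e).

HB.instance Definition _ := Choice.copy (ocat O P) (O + P)%type.

Definition ocat_lt (x y : ocat O P) : bool :=
  match x, y with
  | inl i, inl j => (i < j)%O
  | inl _, inr _ => true
  | inr _, inl _ => false
  | inr i, inr j => (i < j)%O
  end.
Definition ocat_le (x y : ocat O P) : bool := (x == y) || ocat_lt x y.

Lemma ocat_lt_irr : irreflexive ocat_lt.
Proof. by move=> [x|x] /=; rewrite ltxx. Qed.

Lemma ocat_lt_trans : transitive ocat_lt.
Proof. by move=> [y|y] [x|x] [z|z] //=; exact: lt_trans. Qed.

HB.instance Definition _ := @Order.LtLe_isPOrder.Build ocat_display (ocat O P)
  ocat_le ocat_lt (fun _ _ => erefl) ocat_lt_irr ocat_lt_trans.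

Lemma ocat_le_total : total (<=%O : rel (ocat O P)).
Proof.
move=> x y; change (ocat_le x y || ocat_le y x); rewrite /ocat_le.
by case: x y => [x|x] [y|y] //=; rewrite ?orbT //;
  case: (ltgtP x y) => [//|//|->]; rewrite ?eqxx ?orbT.
Qed.

HB.instance Definition _ := @Order.POrder_isTotal.Build ocat_display (ocat O P)
  ocat_le_total.

End OrderedSum.

(** * Substitution in formulas *)

Lemma mem_pmap_some (X : Type) (l : seq {classic (option X)}) (x : {classic X}) :
  (Some x : {classic (option X)}) \in l -> x \in (pmap id l : seq {classic X}).
Proof.
elim: l => //= -[y|] l IH; rewrite inE => /orP[/eqP e|/IH h] //.
  by case: e => ->; rewrite inE eqxx.
by rewrite inE h orbT.
Qed.

Section Terms.
Variables (S : signature).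

Fixpoint tsubst (X Y : Type) (s : X -> sorts S) (s' : Y -> sorts S)
    (r : forall x, sterm s' (s x)) t (u : sterm s t) : sterm s' t :=
  match u in sterm _ t return sterm s' t with
  | TVar x => r x
  | TApp f args => TApp (fun i => tsubst r (args i))
  end.

Lemma teval_tsubst (car : sorts S -> Type)
    (fint : forall f, tuple_in car (fdom f) -> car (fcod f)) (X Y : Type)
    (s : X -> sorts S) (s' : Y -> sorts S) (r : forall x, sterm s' (s x))
    (a : tuple_in car s') t (u : sterm s t) :
  teval fint a (tsubst r u) = teval fint (fun x => teval fint a (r x)) u.
Proof.
by elim: u => //= f args IH; congr fint; apply: functional_extensionality_dep => i.
Qed.

Definition tlift (Y : Type) (s' : Y -> sorts S) (t0 t : sorts S)
    (u : sterm s' t) : sterm (scons t0 s') t :=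
  tsubst (fun y => TVar (scons t0 s') (Some y)) u.

Lemma teval_tlift (car : sorts S -> Type)
    (fint : forall f, tuple_in car (fdom f) -> car (fcod f)) (Y : Type)
    (s' : Y -> sorts S) (t0 : sorts S) (c : car t0) (a : tuple_in car s')
    t (u : sterm s' t) :
  teval fint (tcons c a) (tlift t0 u) = teval fint a u.
Proof. by rewrite teval_tsubst. Qed.

Definition agree (car : sorts S -> Type)
    (fint : forall f, tuple_in car (fdom f) -> car (fcod f)) (X Y : Type)
    (s : X -> sorts S) (s' : Y -> sorts S) (l : seq {classic X})
    (r : forall x : {classic X}, x \in l -> sterm s' (s x))
    (a : tuple_in car s') (b : tuple_in car s) :=
  forall x (h : x \in l), b x = teval fint a (r x h).

(** The list [l] contains the variables that occur in [u]. Asking for a substitution on [l] only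
    matters: formulas may have infinitely many variables in scope, while a formula with parameters
    is allowed finitely many of these. *)
Lemma sterm_subst (X : Type) (s : X -> sorts S) t (u : sterm s t) :
  exists l : seq {classic X}, forall (Y : Type) (s' : Y -> sorts S)
    (r : forall x : {classic X}, x \in l -> sterm s' (s x)),
  exists u' : sterm s' t, forall car fint a b,
    @agree car fint _ _ s s' l r a b -> teval fint a u' = teval fint b u.
Proof.
elim: u => [x|f args IH].
  exists [:: x : {classic X}] => Y s' r.
  by exists (r x (mem_head _ _)) => car fint a b ab; exact/esym/ab.
have {IH}[l IH] := choice IH.
exists (flatten [seq l i | i : 'I__]) => Y s' r.
have sub i x : x \in l i -> x \in flatten [seq l i | i : 'I_(farity f)].
  by move=> h; apply/flatten_mapP; exists i; rewrite ?mem_enum.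
have {}IH i := IH i Y s' (fun x h => r x (sub i x h)).
exists (TApp (fun i => projT1 (cid (IH i)))) => car fint a b ab /=.
congr fint; apply: functional_extensionality_dep => i.
by case: cid => u' /=; apply => x h; apply: ab.
Qed.

(** Passage under a quantifier: the bound variable [None] goes to itself, and it is dropped from the
    list of variables to be substituted. *)
Definition alift (X Y : Type) (s : X -> sorts S) (s' : Y -> sorts S) (t : sorts S)
    (l : seq {classic (option X)})
    (r : forall x : {classic X}, x \in (pmap id l : seq {classic X}) -> sterm s' (s x))
    (v : {classic (option X)}) : v \in l -> sterm (scons t s') (scons t s v).
Proof.
case: v => [x|] h; last exact: (TVar (scons t s') None).
exact: (tlift t (r x (mem_pmap_some h))).
Defined.

Lemma agree_alift (car : sorts S -> Type)
    (fint : forall f, tuple_in car (fdom f) -> car (fcod f)) (X Y : Type)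
    (s : X -> sorts S) (s' : Y -> sorts S) (t : sorts S)
    (l : seq {classic (option X)})
    (r : forall x : {classic X}, x \in (pmap id l : seq {classic X}) -> sterm s' (s x))
    (a : tuple_in car s') (b : tuple_in car s) (c : car t) :
  agree fint r a b -> agree fint (alift t r) (tcons c a) (tcons c b).
Proof. by move=> ab [x|] h //=; rewrite teval_tlift -ab. Qed.

End Terms.

Lemma fo_subst (S : signature) (X : Type) (s : X -> sorts S) (f : fo_form s) :
  exists l : seq {classic X}, forall (Y : Type) (s' : Y -> sorts S)
    (r : forall x : {classic X}, x \in l -> sterm s' (s x)),
  exists g : fo_form s', forall (M : fo_structure S) a b,
    agree (@fo_fun S M) r a b -> fo_sat g a <-> fo_sat f b.
Proof.
elim: f => {X s} [X s t u v|X s rl args|X s|X s f [l1 IH1] g [l2 IH2]|X s t f [l IH]].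
- have [l1 IH1] := sterm_subst u; have [l2 IH2] := sterm_subst v.
  exists (l1 ++ l2) => Y s' r.
  have s1 x : x \in l1 -> x \in l1 ++ l2 by rewrite mem_cat => ->.
  have s2 x : x \in l2 -> x \in l1 ++ l2 by rewrite mem_cat orbC => ->.
  have [u' hu] := IH1 _ _ (fun x h => r x (s1 x h)).
  have [v' hv] := IH2 _ _ (fun x h => r x (s2 x h)).
  exists (FoEq u' v') => M a b ab /=.
  by rewrite (hu _ _ a b) ?(hv _ _ a b) // => x h; apply: ab.
- have {}IH i := sterm_subst (args i); have {IH}[l IH] := choice IH.
  exists (flatten [seq l i | i : 'I__]) => Y s' r.
  have sub i x : x \in l i -> x \in flatten [seq l i | i : 'I_(rarity rl)].
    by move=> h; apply/flatten_mapP; exists i; rewrite ?mem_enum.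
  have {}IH i := IH i Y s' (fun x h => r x (sub i x h)).
  exists (FoRel (fun i => projT1 (cid (IH i)))) => M a b ab /=.
  suff -> : (fun i => teval (@fo_fun S M) a (projT1 (cid (IH i)))) =
      (fun i => teval (@fo_fun S M) b (args i)) by [].
  apply: functional_extensionality_dep => i.
  by case: cid => u' /=; apply => x h; apply: ab.
- by exists [::] => Y s' r; exists (FoFalse s').
- exists (l1 ++ l2) => Y s' r.
  have s1 x : x \in l1 -> x \in l1 ++ l2 by rewrite mem_cat => ->.
  have s2 x : x \in l2 -> x \in l1 ++ l2 by rewrite mem_cat orbC => ->.
  have [f' hf] := IH1 _ _ (fun x h => r x (s1 x h)).
  have [g' hg] := IH2 _ _ (fun x h => r x (s2 x h)).
  exists (FoImp f' g') => M a b ab /=.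
  by rewrite (hf _ a b) ?(hg _ a b) // => x h; apply: ab.
- exists (pmap id l) => Y s' r.
  have [g hg] := IH _ _ (alift t r).
  exists (FoAll g) => M a b ab /=.
  by split=> h c; apply/(hg _ _ _ (agree_alift c ab)).
Qed.

Lemma ct_subst (R : realType) (S : metric_signature R) (X : Type)
    (s : X -> sorts S) (f : ct_form s) :
  exists l : seq {classic X}, forall (Y : Type) (s' : Y -> sorts S)
    (r : forall x : {classic X}, x \in l -> sterm s' (s x)),
  exists g : ct_form s', forall (M : ct_structure S) a b,
    agree (car := fun t => ct_car M t) (@ct_fun R S M) r a b ->
    ct_val g a = ct_val f b.
Proof.
elim: f => {X s} [X s t u v|X s rl args|X s n u fs IH|X s t f [l IH]|X s t f [l IH]].
- have [l1 IH1] := sterm_subst u; have [l2 IH2] := sterm_subst v.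
  exists (l1 ++ l2) => Y s' r.
  have s1 x : x \in l1 -> x \in l1 ++ l2 by rewrite mem_cat => ->.
  have s2 x : x \in l2 -> x \in l1 ++ l2 by rewrite mem_cat orbC => ->.
  have [u' hu] := IH1 _ _ (fun x h => r x (s1 x h)).
  have [v' hv] := IH2 _ _ (fun x h => r x (s2 x h)).
  exists (CtDist u' v') => M a b ab /=.
  by rewrite (hu _ _ a b) ?(hv _ _ a b) // => x h; apply: ab.
- have {}IH i := sterm_subst (args i); have {IH}[l IH] := choice IH.
  exists (flatten [seq l i | i : 'I__]) => Y s' r.
  have sub i x : x \in l i -> x \in flatten [seq l i | i : 'I_(rarity rl)].
    by move=> h; apply/flatten_mapP; exists i; rewrite ?mem_enum.
  have {}IH i := IH i Y s' (fun x h => r x (sub i x h)).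
  exists (CtRel (fun i => projT1 (cid (IH i)))) => M a b ab /=.
  congr ct_rel; apply: functional_extensionality_dep => i.
  by case: cid => u' /=; apply => x h; apply: ab.
- have {IH}[l IH] := choice IH.
  exists (flatten [seq l i | i : 'I__]) => Y s' r.
  have sub i x : x \in l i -> x \in flatten [seq l i | i : 'I_n].
    by move=> h; apply/flatten_mapP; exists i; rewrite ?mem_enum.
  have {}IH i := IH i Y s' (fun x h => r x (sub i x h)).
  exists (CtConn u (fun i => projT1 (cid (IH i)))) => M a b ab /=.
  congr (conn u _); apply/rowP => i; rewrite !mxE.
  by case: cid => u' /=; apply => x h; apply: ab.
- exists (pmap id l) => Y s' r; have [g hg] := IH _ _ (alift t r).
  exists (CtSup g) => M a b ab /=; congr sup; apply: eq_imagel => c _.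
  apply: hg.
  exact: (@agree_alift S (fun t => ct_car M t) _ _ _ _ _ _ _ _ _ _ c ab).
- exists (pmap id l) => Y s' r; have [g hg] := IH _ _ (alift t r).
  exists (CtInf g) => M a b ab /=; congr inf; apply: eq_imagel => c _.
  apply: hg.
  exact: (@agree_alift S (fun t => ct_car M t) _ _ _ _ _ _ _ _ _ _ c ab).
Qed.

(** * The number of formulas *)

(** Equality proofs are propositions, so proof irrelevance gives their uniqueness; no decidability
    of the sorts is needed for transports. *)
Lemma eq_rect_id (T : Type) (P : T -> Type) (x : T) (u : P x) (e : x = x) :
  eq_rect x P u x e = u.
Proof. by rewrite (Prop_irrelevance e erefl). Qed.

Lemma existT_inj2 (T : Type) (F : T -> Type) (t : T) (u v : F t) :
  existT F t u = existT F t v -> u = v.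
Proof.
move=> e; have := projT2_eq e => /=.
by rewrite (Prop_irrelevance (projT1_eq e) erefl).
Qed.

Definition wpair (T : Type) (a b : T) (k : nat) : T := if k == 0%N then a else b.

Lemma wpair_inj (T : Type) (a b a' b' : T) :
  wpair a b = wpair a' b' -> a = a' /\ b = b'.
Proof.
by move=> e; have := congr1 (fun f => f 0%N) e; have := congr1 (fun f => f 1%N) e.
Qed.

Section Codes.
Variables (S : signature) (V D : Type).

(** [V] labels the free variables, [nat] the bound ones, and [D] the connectives and other formula
    constructors. *)
Definition clabel := (V + nat + symbols S + D)%type.
Definition lvar (v : V + nat) : clabel := inl (inl v).
Definition lsym (v : symbols S) : clabel := inl (inr v).

Definition wargs n (c : 'I_n -> wtree clabel) (k : nat) : wtree clabel :=
  if insub k is Some i then c i else WLeaf.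

Lemma wargs_inj n : injective (@wargs n).
Proof.
move=> c c' e; apply/funext => i.
by have := congr1 (fun f => f (val i)) e; rewrite /wargs valK.
Qed.

Fixpoint tcode (X : Type) (s : X -> sorts S) (e : X -> V + nat) t
    (u : sterm s t) : wtree clabel :=
  match u with
  | TVar x => WNode (lvar (e x)) (fun=> WLeaf)
  | TApp f args => WNode (lsym (inl (inr f))) (wargs (fun i => tcode e (args i)))
  end.

(** Two terms with the same code are not known beforehand to have the same sort; it is recovered
    from the head symbol, whence the dependent pairs. *)
Lemma tcode_inj (X : Type) (s : X -> sorts S) (e : X -> V + nat) : injective e ->
  forall t (u : sterm s t) t' (v : sterm s t'), tcode e u = tcode e v ->
  existT (sterm s) t u = existT (sterm s) t' v.
Proof.
move=> eI t; elim=> [x|f args IH] t' [x'|f' args'] //= [].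
  by move=> /eI ->.
move=> ef; subst f' => /wargs_inj ea; congr (existT _ _ (TApp _)).
apply: functional_extensionality_dep => i; apply: existT_inj2; apply: IH.
by have := congr1 (fun f => f i) ea.
Qed.

Definition eopt (X : Type) (e : X -> V + nat) (d : nat) (v : option X) : V + nat :=
  if v is Some x then e x else inr d.

(* Bound variables are coded by their quantifier depth. *)
Definition fresh (X : Type) (e : X -> V + nat) (d : nat) :=
  injective e /\ forall x k, e x = inr k -> (k < d)%N.

Lemma fresh_eopt (X : Type) (e : X -> V + nat) (d : nat) :
  fresh e d -> fresh (eopt e d) d.+1.
Proof.
move=> [eI ed]; split=> [[x|] [y|] //=|[x|] k /=].
- by move=> /eI ->.
- by move=> /ed; rewrite ltnn.
- by move=> /esym/ed; rewrite ltnn.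
- by move=> /ed /leqW.
- by move=> [->].
Qed.

End Codes.

Fixpoint fo_code (S : signature) (V : Type) (X : Type) (s : X -> sorts S)
    (e : X -> V + nat) (d : nat) (f : fo_form s) : wtree (clabel S V nat) :=
  match f with
  | FoEq _ u v => WNode (inr 0%N) (wpair (tcode nat e u)
      (tcode nat e v))
  | FoRel r args => WNode (lsym V nat (inr r)) (wargs (fun i => tcode nat e (args i)))
  | FoFalse => WNode (inr 1%N) (fun=> WLeaf)
  | FoImp f g => WNode (inr 2%N) (wpair (fo_code e d f)
      (fo_code e d g))
  | FoAll t f => WNode (lsym V nat (inl (inl t)))
      (fun=> fo_code (eopt e d) d.+1 f)
  end.

Lemma fo_code_inj (S : signature) (V : Type) (X : Type) (s : X -> sorts S)
    (e : X -> V + nat) (d : nat) : fresh e d -> injective (@fo_code S V X s e d).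
Proof.
move=> + f; elim: f e d
  => {X s} [X s t u v|X s r args|X s|X s f IHf g IHg|X s t f IH] e d ed
     [t' u' v'|r' args'|| f' g'|t' f'] //= [].
- move=> h; have [eu ev] := wpair_inj h.
  have {}eu := tcode_inj ed.1 eu; have {}ev := tcode_inj ed.1 ev.
  have et := projT1_eq eu; rewrite /= in et; subst t'.
  by rewrite (existT_inj2 eu) (existT_inj2 ev).
- move=> er; subst r' => /wargs_inj ea; suff -> : args = args' by [].
  apply: functional_extensionality_dep => i; apply: (@existT_inj2 _ (sterm s)).
  exact: (tcode_inj ed.1 (congr1 (fun f => f i) ea)).
- by move=> h; have [/(IHf _ _ ed) -> /(IHg _ _ ed) ->] := wpair_inj h.
- move=> et; subst t' => /(congr1 (fun f => f 0%N)) /= ef.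
  by rewrite (IH _ _ (fresh_eopt ed) _ ef).
Qed.

Lemma small_clabel (K : Type) (S : signature) (V D : Type) : strong_limit K ->
  small K [set: symbols S] -> small K [set: V] -> small K [set: D] ->
  small K [set: clabel S V D].
Proof.
move=> Kl sS sV sD; apply: small_sum => //; apply: small_sum => //.
by apply: small_sum => //; exact: small_nat.
Qed.

Lemma small_fo_form (K : Type) (S : signature) (X : Type) (s : X -> sorts S) :
  strong_limit K -> small K [set: symbols S] -> small K [set: X] ->
  small K [set: fo_form s].
Proof.
move=> Kl sS sX; apply: (small_inj (@fo_code_inj S X X s inl 0%N _)).
  by split=> [x y []|].
apply: small_wtree => //; apply: small_clabel => //; exact: small_nat.
Qed.

Section ContinuousCodes.
Variables (R : realType) (S : metric_signature R).
Definition conn_label := (nat + {n & connective R n})%type.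

Fixpoint ct_code (V : Type) (X : Type) (s : X -> sorts S)
    (e : X -> V + nat) (d : nat) (f : ct_form s) : wtree (clabel S V conn_label) :=
  match f with
  | CtDist _ u v => WNode (inr (inl 0%N))
      (wpair (tcode conn_label e u)
      (tcode conn_label e v))
  | CtRel r args => WNode (lsym V conn_label (inr r))
      (wargs (fun i => tcode conn_label e (args i)))
  | CtConn n u fs => WNode (inr (inr (existT _ n u)))
      (wargs (fun i => ct_code e d (fs i)))
  | CtSup t f => WNode (inr (inl 1%N))
      (wpair (WNode (lsym V conn_label (inl (inl t))) (fun=> WLeaf))
      (ct_code (eopt e d) d.+1 f))
  | CtInf t f => WNode (inr (inl 2%N))
      (wpair (WNode (lsym V conn_label (inl (inl t))) (fun=> WLeaf))
      (ct_code (eopt e d) d.+1 f))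
  end.

Lemma ct_code_inj (V : Type) (X : Type) (s : X -> sorts S)
    (e : X -> V + nat) (d : nat) : fresh e d -> injective (@ct_code V X s e d).
Proof.
move=> + f; elim: f e d
  => {X s} [X s t u v|X s r args|X s n u fs IH|X s t f IH|X s t f IH] e d ed
     [t' u' v'|r' args'|n' u' fs'|t' f'|t' f'] //=.
- move=> [] h; have [eu ev] := wpair_inj h.
  have {}eu := tcode_inj ed.1 eu; have {}ev := tcode_inj ed.1 ev.
  have et := projT1_eq eu; rewrite /= in et; subst t'.
  by rewrite (existT_inj2 eu) (existT_inj2 ev).
- move=> [] er; subst r' => /wargs_inj ea; suff -> : args = args' by [].
  apply: functional_extensionality_dep => i; apply: (@existT_inj2 _ (sterm s)).
  exact: (tcode_inj ed.1 (congr1 (fun f => f i) ea)).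
- move=> enu; have en : n = n' by case: enu.
  subst n'; have eu : u = u' by apply: existT_inj2; case: enu.
  subst u'; have /wargs_inj ea : wargs (fun i => ct_code e d (fs i)) =
    wargs (fun i => ct_code e d (fs' i)) by case: enu.
  suff -> : fs = fs' by [].
  apply/funext => i; apply: (IH i _ _ ed).
  by have := congr1 (fun f => f i) ea.
- move=> [] h; have [[et] ef] := wpair_inj h; subst t'.
  by rewrite (IH _ _ (fresh_eopt ed) _ ef).
- move=> [] h; have [[et] ef] := wpair_inj h; subst t'.
  by rewrite (IH _ _ (fresh_eopt ed) _ ef).
Qed.

(** Padding lists with zeros, connectives of all arities become functions [seq R -> R]. All
    functions are counted, since nothing restricts a connective outside the cube. *)
Lemma small_connective (K : Type) : strong_limit K ->
  small K [set: {n & connective R n}].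
Proof.
move=> Kl; have sR := @small_real K Kl R.
apply: (@small_sigT K Kl nat (seq R -> R) (connective R)
  (fun n (u : connective R n) l => u (\row_i nth 0 l i))).
- exact: small_nat.
- by apply: small_fun => //; apply: small_seq.
- move=> n u v e; have {e}: conn u = conn v.
    apply/funext => w; have := congr1 (fun f => f [seq w ord0 i | i : 'I_n]) e.
    suff -> : \row_i nth 0 [seq w ord0 i | i : 'I_n] i = w by [].
    by apply/rowP => i; rewrite !mxE (nth_map i) ?size_enum_ord // nth_ord_enum.
  case: u => u cu ru; case: v => v cv rv /= e; subst v.
  by congr Connective; exact: Prop_irrelevance.
Qed.

Lemma small_ct_form (K : Type) (X : Type) (s : X -> sorts S) :
  strong_limit K -> small K [set: symbols S] -> small K [set: X] ->
  small K [set: ct_form s].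
Proof.
move=> Kl sS sX; apply: (small_inj (@ct_code_inj X X s inl 0%N _)).
  by split=> [x y []|].
apply: small_wtree => //; apply: small_clabel => //.
by apply: small_sum => //; [exact: small_nat|exact: small_connective].
Qed.

End ContinuousCodes.

(** * Classical and continuous logic *)

(* The interface through which the model theory sees both logics; [tdist]
   metrizes the truth values. *)
Record tame (R : realType) (L : logic) := Tame {
  tdist : truth L -> truth L -> R;
  tdist_ge0 : forall x y, 0 <= tdist x y;
  tdistxx : forall x, tdist x x = 0;
  tdistC : forall x y, tdist x y = tdist y x;
  tdist_tri : forall x y z, tdist x z <= tdist x y + tdist y z;
  tdist0_eq : forall x y, tdist x y <= 0 -> x = y;
  tdist_cvg : forall (F : set_system (truth L)) (FF : Filter F) v,
    F --> v <-> forall e, 0 < e -> F [set x | tdist x v <= e];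
  tdist_le1 : forall (M : structure L) (X : Type) (s : X -> lsort L)
    (f : formula s) (a b : tuple_in (car M) s),
    tdist (truth_of f a) (truth_of f b) <= 1;
  near_formula : forall (X : Type) (s : X -> lsort L) (f : formula s) v e,
    0 <= e -> exists g : formula s, forall (M : structure L) a,
    @truth_of L M X s g a = holds <-> tdist (truth_of f a) v <= e;
  conj_formula : forall (X : Type) (s : X -> lsort L) n (f : 'I_n -> formula s),
    exists g : formula s, forall (M : structure L) a,
    @truth_of L M X s g a = holds <-> forall i, truth_of (f i) a = holds;
  subst_formula : forall (X : Type) (s : X -> lsort L) (f : formula s),
    exists l : seq {classic X}, forall (Y : Type) (s' : Y -> lsort L)
      (r : X -> Y -> Prop),
    (forall x : {classic X}, x \in l -> exists2 y, r x y & s' y = s x) ->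
    exists g : formula s', forall (M : structure L) (a : tuple_in (car M) s')
      (b : tuple_in (car M) s),
    (forall (x : {classic X}) y (e : s' y = s x), x \in l -> r x y ->
       b x = eq_rect (s' y) (car M) (a y) (s x) e) ->
    truth_of g a = truth_of f b;
  ultra_lim : forall (I : Type) (U : set_system I) (UU : UltraFilter U)
    (M : structure L) (X : Type) (s : X -> lsort L) (f : formula s)
    (a : I -> tuple_in (car M) s),
    exists v, forall e, 0 < e -> U [set i | tdist (truth_of f (a i)) v <= e];
  small_formula : forall (K : Type), strong_limit K ->
    small K [set: lsymbols L] -> forall (X : Type) (s : X -> lsort L),
    small K [set: X] -> small K [set: formula s];
  small_sort : forall (K : Type), small K [set: lsymbols L] ->
    small K [set: lsort L];
  car_inhabited : forall (M : structure L) t, inhabited (car M t);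
  small_truth : forall (K : Type), strong_limit K -> small K [set: truth L] }.

Lemma teval_rect (S : signature) (car : sorts S -> Type)
    (fint : forall f, tuple_in car (fdom f) -> car (fcod f)) (Y : Type)
    (s' : Y -> sorts S) (a : tuple_in car s') y t (e : s' y = t) :
  teval fint a (eq_rect (s' y) (sterm s') (TVar s' y) t e) =
  eq_rect (s' y) car (a y) t e.
Proof. by case: t / e. Qed.

Definition rect_subst (S : signature) (X Y : Type) (s : X -> sorts S)
    (s' : Y -> sorts S) (l : seq {classic X}) (r : X -> Y -> Prop)
    (h : forall x : {classic X}, x \in l -> exists2 y, r x y & s' y = s x)
    (x : {classic X}) (hx : x \in l) : sterm s' (s x) :=
  let p := cid2 (h x hx) in eq_rect _ (sterm s') (TVar s' (s2val p)) _ (s2valP' p).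

Lemma agree_rect (S : signature) (car : sorts S -> Type)
    (fint : forall f, tuple_in car (fdom f) -> car (fcod f)) (X Y : Type)
    (s : X -> sorts S) (s' : Y -> sorts S) (l : seq {classic X})
    (r : X -> Y -> Prop)
    (h : forall x : {classic X}, x \in l -> exists2 y, r x y & s' y = s x)
    (a : tuple_in car s') (b : tuple_in car s) :
  (forall (x : {classic X}) y (e : s' y = s x), x \in l -> r x y ->
     b x = eq_rect (s' y) car (a y) (s x) e) ->
  agree fint (rect_subst h) a b.
Proof. by move=> H x hx; rewrite teval_rect; apply: H => //; exact: s2valP. Qed.

Section TameClassical.
Variables (R : realType) (S : signature).
Notation L := (classical_logic S).

Definition bdist (x y : bool) : R := (x != y)%:R.

Lemma bdist_le (x y : bool) (e : R) : 0 <= e -> bdist x y <= e <-> (e < 1 -> x = y).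
Proof.
move=> e0; rewrite /bdist; case: eqP => [->|nxy] /=; first by split.
by split=> [e1 /(le_lt_trans e1)|h]; [rewrite ltxx|rewrite leNgt; apply/negP => /h /nxy].
Qed.

Lemma classical_tame : inhabited (tame R L).
Proof.
split; apply: (@Tame R L bdist).
- by move=> x y; rewrite /bdist.
- by move=> x; rewrite /bdist eqxx.
- by move=> x y; rewrite /bdist eq_sym.
- by move=> x y z; rewrite /bdist -natrD ler_nat; move: x y z => [] [] [].
- by move=> x y; rewrite bdist_le // => /(_ ltr01).
- move=> F FF v; split=> [Fv e e0|h].
    apply: Fv; change (nbhs v [set x : bool | bdist x v <= e]).
    by rewrite nbhs_principalE; apply/principal_filterP; rewrite /= /bdist eqxx ltW.
  move=> A; change (nbhs (v : bool) A -> F A).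
  rewrite nbhs_principalE => /principal_filterP Av.
  apply: filterS (h (1 / 2) _) => // x /=; rewrite bdist_le // => -> //.
  by rewrite ltr_pdivrMr // mul1r ltr1n.
- by move=> M X s f a b; rewrite /bdist lern1 leq_b1.
(* From 1 on closeness is no condition and a tautology expresses it; below 1 it is equality,
   expressed by [f] or by its negation. *)
- move=> X s f v e e0; have [e1|e1] := ltP e 1; last first.
    exists (FoImp (FoFalse s) (FoFalse s)) => M a.
    rewrite bdist_le // ltNge e1; split=> // _; apply/asboolP; by [].
  exists (if v then f else FoImp f (FoFalse s)) => M a; rewrite bdist_le // /holds /=.
  case: v; rewrite /fo_val /=; first by split=> // /(_ e1).
  split=> [/asboolP h _|/(_ e1) h]; last by apply/asboolP => /asboolP; rewrite h.
  by apply/asboolP.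
- move=> X s n f; elim: n f => [|n IH] f.
    exists (FoImp (FoFalse s) (FoFalse s)) => M a; split=> [_ []//|_].
    exact/asboolP.
  have [g hg] := IH (fun i => f (lift ord0 i)).
  exists (FoImp (FoImp (f ord0) (FoImp g (FoFalse s))) (FoFalse s)) => M a.
  have {hg} := hg M a; rewrite /= /fo_val => hg; split.
    move=> /asboolP /= h i; apply/asboolP.
    have [h0|h0] := pselect (fo_sat (f ord0) a); last by exfalso; apply: h.
    have [h1|h1] := pselect (fo_sat g a); last by exfalso; apply: h.
    have [j ->|->] := unliftP ord0 i; last by [].
    by apply/asboolP; apply: hg.1; apply/asboolP.
  move=> h; apply/asboolP => /= h'; apply: h'.
    by have /asboolP := h ord0.
  by apply/asboolP/hg => i; exact: h.
- move=> X s f; have [l hl] := fo_subst f; exists l => Y s' r h.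
  have [g hg] := hl Y s' (rect_subst h); exists g => M a b ab.
  rewrite /= /fo_val; apply: asbool_equiv_eq.
  by apply: hg; exact: (@agree_rect _ _ _ _ _ _ _ _ _ h).
- move=> I U UU M X s f a.
  have [h|h] := in_ultra_setVsetC [set i | fo_val f (a i)] UU.
    exists true => e e0; apply: filterS h => i /= ->.
    by rewrite /bdist eqxx ltW.
  exists false => e e0; apply: filterS h => i /= /negP/negbTE ->.
  by rewrite /bdist eqxx ltW.
- by move=> K Kl sS X s sX; exact: small_fo_form.
- by move=> K; apply: (@small_inj _ _ _ (fun t => inl (inl t))) => x y [].
- exact: fo_inhabited.
- move=> K Kl; apply: (@small_inj _ _ _ nat_of_bool); last exact: small_nat.
  by move=> [] [].
Qed.

End TameClassical.

Section TameContinuous.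
Variables (R : realType) (S : metric_signature R).
Notation L := (continuous_logic S).

Lemma ct_val_range (M : ct_structure S) (X : Type) (s : X -> sorts S)
    (f : ct_form s) (a : tuple_in (fun t => ct_car M t) s) : 0 <= ct_val f a <= 1.
Proof.
elim: f a => {X s} [X s t u v|X s r args|X s n u fs IH|X s t f IH|X s t f IH] a /=.
- by rewrite mdist_ge0 ct_diameter.
- exact: ct_rel_range.
- by apply: conn_range => i; rewrite mxE.
- have [c] := ct_inhabited M t.
  have ub : ubound (range (fun c : ct_car M t =>
      ct_val f (@tcons _ (ct_car M) _ t s c a))) 1.
    by move=> _ [d _ <-]; have /andP[] := IH (@tcons _ (ct_car M) _ t s d a).
  apply/andP; split; last by apply: ge_sup => //; eexists; exists c.
  have /andP[h _] := IH (@tcons _ (ct_car M) _ t s c a).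
  by apply: (le_trans h); apply: ub_le_sup; [exists 1|exists c].
- have [c] := ct_inhabited M t.
  have lb : lbound (range (fun c : ct_car M t =>
      ct_val f (@tcons _ (ct_car M) _ t s c a))) 0.
    by move=> _ [d _ <-]; have /andP[] := IH (@tcons _ (ct_car M) _ t s d a).
  apply/andP; split; first by apply: lb_le_inf => //; eexists; exists c.
  have /andP[_ h] := IH (@tcons _ (ct_car M) _ t s c a).
  by apply: le_trans h; apply: ge_inf; [exists 0|exists c].
Qed.

(** The connective is [|w - v| - e] truncated to the unit interval. It vanishes exactly on the
    closed ball, and 0 is the value of truth. *)
Lemma near_conn (v e : R) : 0 <= e -> exists u : connective R 1,
  forall w, u w = 0 <-> `|w ord0 ord0 - v| <= e.
Proof.
move=> e0.
pose g (w : 'rV[R]_1) : R := Num.min 1 (Num.max 0 (`|w ord0 ord0 - v| - e)).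
have gc : {within @cube R 1, continuous g}.
  apply: continuous_subspaceT => w.
  apply: (@continuous_min R _ (fun=> 1)
    (fun w : 'rV[R]_1 => Num.max 0 (`|w ord0 ord0 - v| - e))); first exact: cst_continuous.
  apply: (@continuous_max R _ (fun=> 0) (fun w : 'rV[R]_1 => `|w ord0 ord0 - v| - e)).
    exact: cst_continuous.
  apply: continuousB; last exact: cst_continuous.
  apply: (@continuous_comp _ _ _ (fun w : 'rV[R]_1 => w ord0 ord0 - v) Num.norm);
    last exact: norm_continuous.
  by apply: continuousB; [exact: coord_continuous|exact: cst_continuous].
have gr w : @cube R 1 w -> 0 <= g w <= 1.
  by move=> _; rewrite /g le_min ler01 le_max lexx ge_min lexx.
exists (Connective gc gr) => w /=; rewrite /g -subr_le0.
split=> [h|h]; last by rewrite (max_idPl h); apply/min_idPr.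
rewrite leNgt; apply/negP => p; have : 0 < g w by rewrite lt_min ltr01 lt_max p orbT.
by rewrite /g h ltxx.
Qed.

(** A sum of absolute values vanishes only if each of them does; truncation at 1 keeps it a
    connective. *)
Lemma conj_conn n : exists u : connective R n,
  forall w, u w = 0 <-> forall i, w ord0 i = 0.
Proof.
pose g (w : 'rV[R]_n) : R := Num.min 1 (\sum_i `|w ord0 i|).
have sge w : 0 <= \sum_i `|(w : 'rV[R]_n) ord0 i| by apply: sumr_ge0.
have gc : {within @cube R n, continuous g}.
  apply: continuous_subspaceT => w.
  apply: (@continuous_min R _ (fun=> 1) (fun w : 'rV[R]_n => \sum_i `|w ord0 i|)).
    exact: cst_continuous.
  elim: (index_enum _) => [|i r IH].
    have -> : (fun w : 'rV[R]_n => \sum_(i <- [::]) `|w ord0 i|) = fun=> 0.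
      by apply/funext => ?; rewrite big_nil.
    exact: cst_continuous.
  have -> : (fun w : 'rV[R]_n => \sum_(j <- i :: r) `|w ord0 j|) =
      (fun w => `|w ord0 i|) \+ (fun w => \sum_(j <- r) `|w ord0 j|).
    by apply/funext => ?; rewrite big_cons.
  apply: continuousD => //.
  apply: (@continuous_comp _ _ _ (fun w : 'rV[R]_n => w ord0 i) Num.norm);
    [exact: coord_continuous|exact: norm_continuous].
have gr w : @cube R n w -> 0 <= g w <= 1.
  by move=> _; rewrite /g le_min ler01 sge ge_min lexx.
exists (Connective gc gr) => w /=; rewrite /g; split=> [|h]; last first.
  rewrite big1 ?minEle; last by move=> i _; rewrite h normr0.
  by rewrite leNgt ltr01.
case: leP => [_ /eqP|_ h i]; first by rewrite oner_eq0.
move/eqP: h; rewrite psumr_eq0 // => /allP/(_ i).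
by rewrite mem_index_enum normr_eq0 => /(_ isT) /eqP.
Qed.

Lemma continuous_tame : inhabited (tame R L).
Proof.
split; apply: (@Tame R L (fun x y : R => `|x - y|)).
- by move=> x y.
- by move=> x; rewrite subrr normr0.
- by move=> x y; exact: distrC.
- by move=> x y z; exact: ler_distD.
- by move=> x y; rewrite normr_le0 subr_eq0 => /eqP.
- move=> F FF v; split=> [Fv e e0|h].
    apply: filterS (Fv _ (nbhsx_ballx (v : R) e e0)) => x.
    by rewrite /ball /= distrC => /ltW.
  move=> A /(@nbhs_ballP R R)[e /= e0 eA].
  have e20 : 0 < e / 2 by rewrite divr_gt0.
  apply: filterS (h _ e20) => x /= xv; apply: eA.
  by rewrite /ball /= distrC (le_lt_trans xv) // ltr_pdivrMr // ltr_pMr // ltr1n.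
- move=> M X s f a b /=; have /andP[a0 a1] := ct_val_range f a.
  have /andP[b0 b1] := ct_val_range f b.
  by rewrite ler_norml; apply/andP; split; lra.
- move=> X s f v e e0; have [u hu] := near_conn v e0.
  by exists (CtConn u (fun=> f)) => M a /=; rewrite hu mxE.
- move=> X s n f; have [u hu] := conj_conn n.
  exists (CtConn u f) => M a /=; rewrite hu.
  by split=> h i; have := h i; rewrite mxE.
- move=> X s f; have [l hl] := ct_subst f; exists l => Y s' r h.
  have [g hg] := hl Y s' (rect_subst h); exists g => M a b ab.
  by apply: hg; exact: (@agree_rect _ _ _ _ _ _ _ _ _ h).
- move=> I U UU M X s f a.
  have := @segment_compact R 0 1 (ct_val f \o a @ U) _.
  case.
    apply: (@filterS _ U _ setT); last exact: filterT.
    by move=> i _; rewrite /= in_itv; exact: ct_val_range.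
  move=> v [_ vcl]; exists v => e e0.
  (* The cluster point [v] given by compactness is a limit: otherwise [U] contains the complement of
     a neighbourhood, which [v] could not adhere to. *)
  have [//|h] := in_ultra_setVsetC [set i | `|ct_val f (a i) - v| <= e] UU.
  have gC : (ct_val f \o a @ U)
      ((ct_val f \o a) @` (~` [set i | `|ct_val f (a i) - v| <= e])).
    by apply: (@filterS _ U _ _ _ _ h) => i ni; exists i.
  have [_ [[i /= ni <-]]] := vcl _ _ gC (nbhsx_ballx v e e0).
  by rewrite /ball /= distrC => /ltW.
- by move=> K Kl sS X s sX; exact: small_ct_form.
- by move=> K; apply: (@small_inj _ _ _ (fun t => inl (inl t))) => x y [].
- by move=> M0 t; have [c] := ct_inhabited M0 t.
- by move=> K Kl; exact: small_real.
Qed.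

End TameContinuous.

Lemma language_tame (R : realType) (L : language R) : inhabited (tame R L).
Proof. by case: L => S; [exact: classical_tame|exact: continuous_tame]. Qed.

(** * Saturation and homogeneity *)

Lemma mem_classic (T : eqType) (E : seq T) (x : T) :
  ((x : {classic T}) \in (E : seq {classic T})) = (x \in E).
Proof. by elim: E => // y E IH; rewrite !inE IH; congr (_ || _); apply/eqP/eqP. Qed.

Definition subset_elt (T : Type) (A : set T) x (Ax : A x) : A :=
  exist (fun x => x \in A) x (mem_set Ax).

Section ModelTheory.
Variables (R : realType) (L : logic) (TL : tame R L) (M : structure L).
Variables (K : Type) (MK : monster M K).

Local Notation tup s := (tuple_in (car M) s).
Local Notation elt := (elt M).
Local Notation dist := (tdist TL).

Lemma monster_lim : strong_limit K. Proof. by case: MK. Qed.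
Lemma monster_symbols : small K [set: lsymbols L]. Proof. by case: MK. Qed.

Lemma tdist_eq (x y : truth L) : (forall e, 0 < e -> dist x y <= e) -> x = y.
Proof.
move=> h; apply: (@tdist0_eq _ _ TL).
by apply/ler_addgt0Pr => e e0; rewrite add0r; exact: h.
Qed.

(* Substitutions of variables and constants, presented semantically so that
   equalities between sorts are dealt with once and for all. *)
Definition simple (B : set elt) (Y X : Type) (s' : Y -> lsort L)
    (s : X -> lsort L) (T : tup s' -> tup s) :=
  forall x, (exists y (e : s' y = s x), forall a, T a x = eq_rect _ (car M) (a y) _ e) \/
    (exists2 c : car M (s x), B (existT _ _ c) & forall a, T a x = c).

Definition definable (B : set elt) (X : Type) (s : X -> lsort L)
    (F : tup s -> truth L) :=
  exists2 g : pform M s, params_in B g & forall a, pval g a = F a.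

(** Only the constants put in place of the finitely many variables occurring in [f] are met; they
    form the list [cs] and become the parameters. *)
Lemma definable_simple (B : set elt) (Y X : Type) (s' : Y -> lsort L)
    (s : X -> lsort L) (T : tup s' -> tup s) (f : formula s) :
  simple B T -> definable B (fun a => truth_of f (T a)).
Proof.
move=> sT; have [l hl] := subst_formula TL f.
pose isc x (c : car M (s x)) := B (existT _ _ c) /\ forall a, T a x = c.
pose cst (x : {classic X}) : seq {classic elt} :=
  if pselect (exists c, isc x c) is left h then [:: existT _ _ (projT1 (cid h))]
  else [::].
pose cs := flatten [seq cst x | x <- l].
have csB c : c \in cs -> B c.
  move=> /flatten_mapP[x _]; rewrite /cst; case: pselect => // h.
  by rewrite inE => /eqP ->; case: cid => d [].
pose q (i : 'I_(size cs)) := projT1 (tnth (in_tuple cs) i : elt).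
pose b : tup q := fun i => projT2 (tnth (in_tuple cs) i : elt).
pose r x (v : Y + 'I_(size cs)) := match v with
  | inl y => exists e : s' y = s x, forall a, T a x = eq_rect _ (car M) (a y) _ e
  | inr i => exists e : q i = s x, forall a, T a x = eq_rect _ (car M) (b i) _ e
  end.
have [x xl|g hg] := hl _ (sapp s' q) r.
  have [[y [e he]]|[c Bc hc]] := sT x; first by exists (inl y) => //; exists e.
  have [d [dcs hd]] : exists d : car M (s x),
      (existT _ _ d : {classic elt}) \in cs /\ forall a, T a x = d.
    have ex : exists c, isc x c by exists c.
    exists (projT1 (cid ex)); split; last by case: cid => d [].
    apply/flatten_mapP; exists x => //; rewrite /cst.
    case: pselect => // h; rewrite inE; apply/eqP; congr existT.
    by rewrite (Prop_irrelevance h ex).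
  have [i ei] := tnthP (in_tuple cs) _ dcs.
  have e : q i = s x by rewrite /q -ei.
  exists (inr i) => //; exists e => a; rewrite hd; move: e; rewrite /b /q.
  by rewrite -ei /= => e; rewrite (Prop_irrelevance e erefl).
exists (@PForm L M Y s' _ q g b).
  by move=> i; apply: csB; rewrite /q /b -sigT_eta; exact: mem_tnth.
move=> a; apply: hg => x [y|i] e xl [e' he'] /=; rewrite he';
  by rewrite (Prop_irrelevance e e').
Qed.

(** A formula at [T a] is a formula over [A] at [a], the constants of [T] being found in the
    enumeration [tset A]. *)
Lemma eqtp_simple (A : set elt) (Y X : Type) (s' : Y -> lsort L)
    (s : X -> lsort L) (T : tup s' -> tup s) (a b : tup s') :
  simple A T -> eqtp A a b -> eqtp set0 (T a) (T b).
Proof.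
move=> sT ab f; have [l hl] := subst_formula TL f.
pose r (x : X + (set0 : set elt)) (v : Y + A) := match x, v with
  | inl x, inl y => exists e : s' y = s x, forall a, T a x = eq_rect _ (car M) (a y) _ e
  | inl x, inr c => exists e : sset A c = s x,
      forall a, T a x = eq_rect _ (car M) (tset A c) _ e
  | inr _, _ => False
  end.
have [[x|[x x0]] xl|g hg] := hl _ (sapp s' (sset A)) r.
- have [[y [e he]]|[c Ac hc]] := sT x; first by exists (inl y) => //; exists e.
  by exists (inr (subset_elt Ac)) => //; exists erefl.
- by exfalso; have := x0; rewrite inE.
- have hT c : truth_of g (tapp c (tset A)) = truth_of f (tapp (T c) (tset set0)).
    apply: hg => -[x|z] [y|d] e xl //= [e' he']; rewrite he';
      by rewrite (Prop_irrelevance e e').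
  by rewrite -!hT.
Qed.

Lemma simple_tapp (B A : set elt) (Y X : Type) (s' : Y -> lsort L)
    (s : X -> lsort L) (T : tup s' -> tup s) :
  A `<=` B -> simple B T -> simple B (fun a => tapp (T a) (tset A)).
Proof.
move=> AB sT [x|c]; first exact: sT.
right; exists (tset A c) => //; apply: AB; rewrite /tset /sset -sigT_eta.
exact: set_valP.
Qed.

Lemma eqtp0 (X : Type) (s : X -> lsort L) (a b : tup s) :
  eqtp set0 a b <-> forall f : formula s, truth_of f a = truth_of f b.
Proof.
split=> [ab f|ab f].
  have [l hl] := subst_formula TL f.
  have [x xl|g hg] := hl _ (sapp s (sset (set0 : set elt)))
      (fun x v => v = inl x); first by exists (inl x).
  have h c : truth_of g (tapp c (tset set0)) = truth_of f c.
    by apply: hg => x y e _ ye; subst y; rewrite (Prop_irrelevance e erefl).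
  by rewrite -!h.
have [l hl] := subst_formula TL f.
have [[x|[x x0]] xl|g hg] := hl _ s (fun v x => v = inl x); first by exists x.
  by exfalso; have := x0; rewrite inE.
have h c : truth_of g c = truth_of f (tapp c (tset set0)).
  by apply: hg => x y e _ xe; subst x; rewrite (Prop_irrelevance e erefl).
by rewrite -!h.
Qed.

Lemma simple_id (B : set elt) (X : Type) (s : X -> lsort L) :
  simple B (fun a : tup s => a).
Proof. by move=> x; left; exists x, erefl. Qed.

(** Appending the enumeration of [A] removes the parameters, as strong homogeneity is assumed for
    types over the empty set only. *)
Lemma eqtpE (A : set elt) (X : Type) (s : X -> lsort L) (a b : tup s) :
  eqtp A a b <-> eqtp set0 (tapp a (tset A)) (tapp b (tset A)).
Proof.
split=> [ab|/eqtp0 //].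
apply: (@eqtp_simple A _ _ s _ (fun c => tapp c (tset A)) a b _ ab).
by apply: simple_tapp => //; exact: simple_id.
Qed.

Lemma eqtp_map (A B : set elt) (Y X : Type) (s' : Y -> lsort L)
    (s : X -> lsort L) (T : tup s' -> tup s) (a b : tup s') :
  B `<=` A -> simple A T -> eqtp A a b -> eqtp B (T a) (T b).
Proof.
move=> BA sT ab; apply/eqtpE.
apply: (@eqtp_simple A _ _ s' _ (fun c => tapp (T c) (tset B)) a b _ ab).
exact: simple_tapp.
Qed.

Lemma eqtp_sub (A B : set elt) (X : Type) (s : X -> lsort L) (a b : tup s) :
  B `<=` A -> eqtp A a b -> eqtp B a b.
Proof. by move=> BA; apply: (@eqtp_map A B _ _ s s (fun c => c)) => //; exact: simple_id. Qed.

Lemma eqtp_sym (A : set elt) (X : Type) (s : X -> lsort L) (a b : tup s) :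
  eqtp A a b -> eqtp A b a.
Proof. by move=> h f; rewrite h. Qed.

Lemma eqtp_trans (A : set elt) (X : Type) (s : X -> lsort L) (a b c : tup s) :
  eqtp A a b -> eqtp A b c -> eqtp A a c.
Proof. by move=> h h' f; rewrite h h'. Qed.

Lemma homogeneous_over (A : set elt) (X : Type) (s : X -> lsort L) (a b : tup s) :
  small K A -> small K [set: X] -> eqtp A a b ->
  exists2 g, automorphism_over A g & forall x, g _ (a x) = b x.
Proof.
move=> sA sX /eqtpE ab; have [_ _ _ hom] := MK.
have sXA : small K [set: X + A].
  by apply: small_sum => //; [exact: monster_lim|exact: (small_set K A).1].
have [g gaut hg] := hom _ _ _ _ sXA ab.
exists g; last by move=> x; have := hg (inl x).
split=> // -[t c] Ac.
by have := hg (inr (subset_elt Ac)).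
Qed.

Lemma automorphism_eqtp (A : set elt) (X : Type) (s : X -> lsort L) (a : tup s) g :
  automorphism_over A g -> eqtp A (fun x => g _ (a x)) a.
Proof.
move=> [[gb gt] gA] f; rewrite -[RHS]gt; congr truth_of.
apply: functional_extensionality_dep => -[x|c] //=.
by rewrite /tset gA //; exact: set_valP.
Qed.

Lemma positive_lower_bound n (e : 'I_n -> R) : (forall k, 0 < e k) ->
  exists2 d, 0 < d & forall k, d <= e k.
Proof.
elim: n e => [|n IH] e e0; first by exists 1 => // -[].
have [d d0 hd] := IH (fun k => e (lift ord0 k)) (fun k => e0 _).
exists (Num.min d (e ord0)) => [|k]; first by rewrite lt_min d0 e0.
by have [j ->|->] := unliftP ord0 k; rewrite ge_min ?hd // lexx orbT.
Qed.

(** Saturation is assumed for formulas that hold. Each equation [F i a = v i] is split into the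
    conditions that the distance be at most [e], which are such formulas by [near_formula]; thus
    finite parts need only be solved approximately. *)
Lemma saturation (B : set elt) (X : Type) (s : X -> lsort L) (I : Type)
    (F : I -> tup s -> truth L) (v : I -> truth L) :
  small K [set: X] -> small K B -> (forall i, definable B (F i)) ->
  (forall n (i : 'I_n -> I) e, 0 < e ->
    exists a, forall k, dist (F (i k) a) (v (i k)) <= e) ->
  exists a, forall i, F i a = v i.
Proof.
move=> sX sB Fdef fin; have [_ _ sat _] := MK.
pose G : set (pform M s) := [set h | params_in B h /\ exists i e, 0 < e /\
  forall a, pval h a = holds <-> dist (F i a) (v i) <= e].
have [h []//|n f Gf|a ha] := sat X s B G sX sB.
  have [i hi] := choice (fun k => (Gf k).2).
  have [e he] := choice hi.
  have [d d0 hd] := positive_lower_bound (fun k => (he k).1).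
  have [a ha] := fin n i d d0; exists a => k.
  by apply/(he k).2; apply: le_trans (ha k) (hd k).
exists a => i; apply: tdist_eq => e e0.
have [g gB hg] := Fdef i.
have [h hh] := near_formula TL (body g) (v i) (ltW e0).
pose h' := @PForm L M X s (par g) (psort g) h (args g).
have hh' c : pval h' c = holds <-> dist (F i c) (v i) <= e by rewrite hh -hg.
by apply/hh'; apply: ha; split=> //; exists i, e.
Qed.

(** * Indiscernible sequences *)

Section Indiscernibles.
Variables (A : set elt) (X : Type) (s : X -> lsort L).

Definition increasing (O : Type) (lt : O -> O -> Prop) n (i : 'I_n -> O) :=
  forall k l : 'I_n, (k < l)%N -> lt (i k) (i l).

Definition realizes (Q : emtype s A) (O : Type) (lt : O -> O -> Prop)
    (a : O -> tup s) :=
  forall n (i : 'I_n -> O), increasing lt i ->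
  forall f, truth_of f (tapp (flat (fun k => a (i k))) (tset A)) = Q n f.

Lemma realizes_indiscernible (Q : emtype s A) (O : Type) (lt : O -> O -> Prop)
    (a : O -> tup s) : realizes Q lt a -> indiscernible A lt a.
Proof. by move=> aQ n i j hi hj f; rewrite !(aQ n). Qed.

Lemma indiscernible_realizes (O : Type) (lt : O -> O -> Prop)
    (a : O -> tup s) (u : nat -> O) : indiscernible A lt a ->
  (forall m n, (m < n)%N -> lt (u m) (u n)) ->
  exists Q : emtype s A, realizes Q lt a.
Proof.
move=> ia uinc.
exists (fun n f => truth_of f (tapp (flat (fun k : 'I_n => a (u k))) (tset A))).
by move=> n i iinc f; apply: ia => // k l; apply: uinc.
Qed.

Lemma indiscernible_sub (O P : Type) (lt : O -> O -> Prop)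
    (lt' : P -> P -> Prop) (a : O -> tup s) (h : P -> O) :
  (forall p q, lt' p q -> lt (h p) (h q)) ->
  indiscernible A lt a -> indiscernible A lt' (fun p => a (h p)).
Proof.
move=> hinc ia n i j iinc jinc.
by apply: (ia n (fun k => h (i k)) (fun k => h (j k))) => k l /[dup] kl;
  [move=> /iinc/hinc|move=> /jinc/hinc].
Qed.

Lemma realizes_sub (Q : emtype s A) (O P : Type) (lt : O -> O -> Prop)
    (lt' : P -> P -> Prop) (a : O -> tup s) (h : P -> O) :
  (forall p q, lt' p q -> lt (h p) (h q)) ->
  realizes Q lt a -> realizes Q lt' (fun p => a (h p)).
Proof.
move=> hinc aQ n i iinc f.
by apply: (aQ n (fun k => h (i k))) => k l kl; apply/hinc/iinc.
Qed.

Lemma finite_chain (Z O : Type) (lt : O -> O -> Prop) (p : Z -> O)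
    (F : seq {classic Z}) :
  (forall x y z, lt x y -> lt y z -> lt x z) ->
  (forall x y, [\/ lt x y, x = y | lt y x]) ->
  exists n (w : 'I_n -> Z), increasing lt (fun k => p (w k)) /\
    forall z : {classic Z}, z \in F -> exists k, p (w k) = p z.
Proof.
move=> tr tri; pose le (x y : {classic O}) : bool := `[< lt x y \/ x = y >].
pose pc : {classic Z} -> {classic O} := p.
pose r := sort le (undup (map pc F)).
have le_tr : transitive le.
  move=> y x z /asboolP[xy|->] /asboolP[yz|<-]; apply/asboolP;
    by [left; exact: tr yz|left|left|right].
have leo : total le.
  move=> x y; apply/orP; have [xy|->|yx] := tri x y;
    [left|left|right]; apply/asboolP; by [left|right].
have rs : sorted le r by exact: sort_sorted.
have ru : uniq r by rewrite sort_uniq undup_uniq.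
have rF (o : {classic O}) : o \in r = (o \in map pc F).
  by rewrite mem_sort mem_undup.
have /choice[w hw] k : exists z, (p z : {classic O}) = tnth (in_tuple r) k.
  have := mem_tnth k (in_tuple r); rewrite rF => /mapP[z _ e].
  by exists z.
exists (size r), w; split.
  move=> k l kl; rewrite !hw.
  have r0 := tnth (in_tuple r) k.
  rewrite !(tnth_nth r0) /=.
  have := sorted_ltn_nth le_tr r0 rs k l (ltn_ord k) (ltn_ord l) kl.
  move=> /asboolP[//|e]; exfalso.
  have /eqP := e; rewrite nth_uniq ?ltn_ord // => /eqP kl'.
  by move: kl; rewrite kl' ltnn.
move=> z zF; have : pc z \in r by rewrite rF map_f.
by move=> /(tnthP (in_tuple r))[k e]; exists k; rewrite hw -e.
Qed.

(** A formula mentions finitely many indices [z]. Sorted by [p] and freed of repetitions they form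
    an increasing tuple, whose image under [p'] is increasing too, and [Q] gives both truth
    values. *)
Lemma realizes_eqtp (Q : emtype s A) (Z O O' : Type) (lt : O -> O -> Prop)
    (lt' : O' -> O' -> Prop) (a : O -> tup s) (a' : O' -> tup s)
    (p : Z -> O) (p' : Z -> O') :
  (forall x y z, lt x y -> lt y z -> lt x z) ->
  (forall x y, [\/ lt x y, x = y | lt y x]) ->
  realizes Q lt a -> realizes Q lt' a' ->
  (forall z w, lt (p z) (p w) -> lt' (p' z) (p' w)) ->
  (forall z w, p z = p w -> p' z = p' w) ->
  eqtp A (flat (fun z => a (p z))) (flat (fun z => a' (p' z))).
Proof.
move=> tr tri aQ aQ' plt peq f; have [l hl] := subst_formula TL f.
pose F : seq {classic Z} := pmap (fun v : {classic (Z * X) + A} =>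
  if v is inl zx then Some (zx.1 : {classic Z}) else None) l.
have [n [w [winc wF]]] := finite_chain p F tr tri.
pose r (v : (Z * X) + A) (v' : ('I_n * X) + A) := match v, v' with
  | inl zx, inl kx => p (w kx.1) = p zx.1 /\ kx.2 = zx.2
  | inr c, inr c' => c = c'
  | _, _ => False
  end.
have [[[z x]|c] vl|g hg] := hl _ (sapp (fun kx : 'I_n * X => s kx.2) (sset A)) r.
- have zF : (z : {classic Z}) \in F.
    rewrite mem_pmap; apply/mapP; exists (inl (z, x)) => //.
  by have [k ek] := wF z zF; exists (inl (k, x)).
- by exists (inr c).
- have e1 : truth_of f (tapp (flat (fun z => a (p z))) (tset A)) =
      truth_of g (tapp (flat (fun k => a (p (w k)))) (tset A)).
    symmetry; apply: hg => -[[z x]|c] [[k x']|c'] e vl //=.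
      by move=> [/= ep ex]; subst x'; rewrite (Prop_irrelevance e erefl) /flat /= ep.
    by move=> ec; subst c'; rewrite (Prop_irrelevance e erefl).
  have e2 : truth_of f (tapp (flat (fun z => a' (p' z))) (tset A)) =
      truth_of g (tapp (flat (fun k => a' (p' (w k)))) (tset A)).
    symmetry; apply: hg => -[[z x]|c] [[k x']|c'] e vl //=.
      move=> [/= /peq ep ex]; subst x'.
      by rewrite (Prop_irrelevance e erefl) /flat /= ep.
    by move=> ec; subst c'; rewrite (Prop_irrelevance e erefl).
  rewrite e1 e2 (aQ n (fun k => p (w k)) winc).
  rewrite (aQ' n (fun k => p' (w k))) // => k k' kk'; exact/plt/winc.
Qed.

(** The form in which compactness is used from now on: [T y] is a family assembled from an unknown
    [y] and constants, and [F i y = v i] are side conditions. A finite part involves only the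
    increasing tuples inside a finite set [E] of indices. *)
Lemma indiscernible_saturation (B : set elt) (Y : Type) (s' : Y -> lsort L)
    (P : eqType) (lt : P -> P -> Prop) (T : tup s' -> P -> tup s)
    (Q : emtype s A) (I : Type) (F : I -> tup s' -> truth L) (v : I -> truth L) :
  small K B -> A `<=` B -> small K [set: Y] ->
  (forall p, simple B (fun y => T y p)) -> (forall i, definable B (F i)) ->
  (forall (E : seq P) n (i : 'I_n -> I) e, 0 < e -> exists y,
    (forall m (j : 'I_m -> P), (forall k, j k \in E) -> increasing lt j ->
       forall f, truth_of f (tapp (flat (fun k => T y (j k))) (tset A)) = Q m f) /\
    forall k, dist (F (i k) y) (v (i k)) <= e) ->
  exists y, realizes Q lt (T y) /\ forall i, F i y = v i.
Proof.
move=> sB AB sY Tsimple Fdef fin.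
pose W := (I + {n & {j : 'I_n -> P & (increasing lt j *
  formula (sapp (fun p : 'I_n * X => s p.2) (sset A)))%type}})%type.
pose FW (w : W) y := match w with
  | inl i => F i y
  | inr (existT n (existT j (_, f))) =>
      truth_of f (tapp (flat (fun k => T y (j k))) (tset A))
  end.
pose vW (w : W) := match w with
  | inl i => v i
  | inr (existT n (existT j (_, f))) => Q n f
  end.
have [||y hy] := @saturation B Y s' W FW vW sY sB.
- move=> [i|[n [j [jinc f]]]] //=; first exact: Fdef.
  apply: (@definable_simple B _ _ _ _ (fun y => tapp (flat (fun k => T y (j k))) (tset A))).
  by apply: simple_tapp => // -[k x]; exact: Tsimple.
- move=> n w e e0.
  pose E := flatten [seq (if w k is inr (existT n (existT j _)) then
    [seq j l | l : 'I_n] else [::]) | k : 'I_n].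
  have [y [yQ yF]] : exists y, (forall m (j : 'I_m -> P),
      (forall k, j k \in E) -> increasing lt j ->
      forall f, truth_of f (tapp (flat (fun k => T y (j k))) (tset A)) = Q m f) /\
      forall k i, w k = inl i -> dist (F i y) (v i) <= e.
    (* [i0] is a dummy for the positions that carry no side condition. If [I] is empty there is
       none, and the hypothesis is applied to zero conditions. *)
    have [[i0 _]|noI] := pselect (exists i : I, True).
      have [y [yQ yF]] := fin E n (fun k => if w k is inl i then i else i0) e e0.
      by exists y; split=> // k i wk; have := yF k; rewrite wk.
    have [y [yQ _]] := fin E 0%N (fun k : 'I_0 => False_rect I (notF (ltn_ord k))) e e0.
    by exists y; split=> // k i; case: noI; exists i.
  exists y => k; case wk : (w k) => [i|[m [j [jinc f]]]] /=; first exact: yF wk.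
  rewrite yQ //; first by rewrite (tdistxx TL) ltW.
  move=> l; apply/flatten_mapP; exists k; first by rewrite mem_enum.
  by rewrite wk; apply: map_f; rewrite mem_enum.
- exists y; split=> [n j jinc f|i]; last exact: (hy (inl i)).
  exact: (hy (inr (existT _ n (existT _ j (jinc, f))))).
Qed.

End Indiscernibles.

Lemma small_setU (B C : set elt) : small K B -> small K C -> small K (B `|` C).
Proof.
move=> /small_set sB /small_set sC; apply/small_set.
apply: (@small_inj _ _ _ (fun c : B `|` C => match pselect (B (val c)) with
  | left h => inl (subset_elt h)
  | right h => inr (subset_elt (or_ind (fun b => False_rect _ (h b)) id (set_valP c) : C (val c)))
  end)).
  move=> [x xp] [y yp] /=; case: pselect => hx; case: pselect => hy // [] e;
    exact: eq_exist.
by apply: small_sum => //; exact: monster_lim.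
Qed.

Lemma small_range (Y T : Type) (f : Y -> T) : small K [set: Y] ->
  small K (range f).
Proof.
move=> sY; apply/small_set.
apply: (@small_inj _ _ _ (fun c : range f => projT1 (cid2 (set_valP c)))) => // -[x xp] [y yp].
case: cid2 => /= x' _ ex; case: cid2 => /= y' _ ey e.
by apply: eq_exist; rewrite -[LHS]ex -[RHS]ey e.
Qed.

Lemma small_ord n : small K [set: 'I_n].
Proof. exact: small_inj val_inj (small_nat monster_lim). Qed.

Definition params (X : Type) (s : X -> lsort L) (a : tup s) : set elt :=
  range (fun x => existT _ (s x) (a x)).

Lemma small_params (X : Type) (s : X -> lsort L) (a : tup s) :
  small K [set: X] -> small K (params a).
Proof. exact: small_range. Qed.

Lemma params_at (X : Type) (s : X -> lsort L) (a : tup s) x :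
  params a (existT _ (s x) (a x)).
Proof. by exists x. Qed.

Lemma realizes_automorphism (A : set elt) (X : Type) (s : X -> lsort L)
    (Q : emtype s A) (O : Type) (lt : O -> O -> Prop) (a : O -> tup s) g :
  automorphism_over A g -> realizes Q lt a ->
  realizes Q lt (fun o x => g _ (a o x)).
Proof.
move=> gA aQ n i iinc f; rewrite -(aQ n i iinc).
exact: (automorphism_eqtp (flat (fun k => a (i k))) gA).
Qed.

Lemma count_lt (P : eqType) (p q : pred P) (E : seq P) x :
  (forall y, p y -> q y) -> x \in E -> q x -> ~~ p x ->
  (count p E < count q E)%N.
Proof.
move=> pq + qx npx; elim: E => //= y E IH; rewrite inE => /orP[/eqP <-|xE].
  by rewrite qx (negbTE npx) add0n add1n ltnS sub_count.
have := IH xE; have := pq y; case: (p y) => /= [-> //|_ h].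
by rewrite add0n; apply: (leq_trans h); rewrite leq_addl.
Qed.

(** In a finite set [E] of indices, the number of predecessors is strictly increasing for any strict
    partial order, so the chain [u] of the given sequence provides every finite part. *)
Lemma realization_exists (A : set elt) (X : Type) (s : X -> lsort L)
    (Q : emtype s A) (O : Type) (lt : O -> O -> Prop) (a : O -> tup s)
    (u : nat -> O) (P : eqType) (ltP : P -> P -> Prop) :
  small K A -> small K [set: X] -> small K [set: P] -> realizes Q lt a ->
  (forall m n, (m < n)%N -> lt (u m) (u n)) ->
  (forall p, ~ ltP p p) -> (forall p q r, ltP p q -> ltP q r -> ltP p r) ->
  exists b : P -> tup s, realizes Q ltP b.
Proof.
move=> sA sX sP aQ uinc irr tr.
have [|||||y [yQ _]] := @indiscernible_saturation A X s A (P * X)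
    (fun px => s px.2) P ltP (fun y p x => y (p, x)) Q void
    (fun v _ => match v with end) (fun v => match v with end) sA.
- by [].
- by apply: small_prod => //; exact: monster_lim.
- by move=> p x; left; exists (p, x), erefl.
- by case.
- move=> E n i e e0.
  pose h p := u (count (fun q => `[< ltP q p >]) E).
  exists (flat (fun p => a (h p))); split; last by move=> k; case: (i k).
  move=> m j jE jinc f; rewrite -(aQ m (fun k => h (j k))) // => k l kl.
  apply: uinc; apply: (@count_lt _ _ _ _ (j k)) => //.
  + by move=> q /asboolP qk; apply/asboolP; apply: tr qk _; exact: jinc.
  + by apply/asboolP; exact: jinc.
  + by apply/asboolP; exact: irr.
by exists (fun p x => y (p, x)).
Qed.

(** A fresh realization on [P] is moved by an automorphism over [A] so that its restriction along
    [w] becomes the given sequence. *)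
Lemma extension (A : set elt) (X : Type) (s : X -> lsort L)
    (Q : emtype s A) (O : Type) (lt : O -> O -> Prop) (a : O -> tup s)
    (u : nat -> O) (P : eqType) (ltP : P -> P -> Prop) (w : O -> P) :
  small K A -> small K [set: X] -> small K [set: P] -> small K [set: O] ->
  realizes Q lt a -> (forall m n, (m < n)%N -> lt (u m) (u n)) ->
  (forall x y z, lt x y -> lt y z -> lt x z) ->
  (forall x y, [\/ lt x y, x = y | lt y x]) ->
  (forall p, ~ ltP p p) -> (forall p q r, ltP p q -> ltP q r -> ltP p r) ->
  (forall x y, lt x y -> ltP (w x) (w y)) ->
  exists2 b : P -> tup s, realizes Q ltP b & forall o, b (w o) = a o.
Proof.
move=> sA sX sP sO aQ uinc tr tri Pirr Ptr winc.
have [b bQ] := realization_exists sA sX sP aQ uinc Pirr Ptr.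
have ab : eqtp A (flat a) (flat (fun o => b (w o))).
  apply: (@realizes_eqtp A X s Q O O P lt ltP a b id w) => //.
  by move=> z z' ->.
have sOX : small K [set: O * X] by apply: small_prod => //; exact: monster_lim.
have [g gA hg] := homogeneous_over sA sOX (eqtp_sym ab).
exists (fun p x => g _ (b p x)); first exact: realizes_automorphism.
by move=> o; apply: functional_extensionality_dep => x; exact: (hg (o, x)).
Qed.

(** * Limits, continuations, and the determination of a formula *)

Section Sequences.
Variables (X : Type) (s : X -> lsort L) (X_small : small K [set: X]).
Implicit Types (J I : eseq M K s) (f : pform M s).

Definition nat_lt (m n : nat) : Prop := (m < n)%N.

Definition nat_seq (c : nat -> tup s) : eseq M K s :=
  @ESeq L M K X s _ nat (small_nat monster_lim) (inhabits 0%N)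
    (fun i => ex_intro _ i.+1 (ltnSn i)) c.

Lemma ocat_endless J (i : ocat (idx J) nat) : exists j, (i < j)%O.
Proof.
case: i => [i|n]; first by have [j ij] := idx_endless i; exists (inl j).
by exists (inr n.+1); change (n < n.+1)%N.
Qed.

Lemma small_ocat J : small K [set: ocat (idx J) nat].
Proof.
apply: small_sum; [exact: monster_lim|exact: idx_small|].
exact: small_nat monster_lim.
Qed.

Definition cat_seq J (c : nat -> tup s) : eseq M K s :=
  @ESeq L M K X s _ (ocat (idx J) nat) (@small_ocat J) (inhabits (inr 0%N))
    (@ocat_endless J) (seq_cat J c).

Definition cont (A : set elt) J (c : nat -> tup s) :=
  indiscernible A (lt_cat (@idx_lt _ _ _ _ _ J) nat_lt) (seq_cat J c).

Lemma idx_lt_cat J (c : nat -> tup s) (x y : idx (cat_seq J c)) :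
  idx_lt x y <-> lt_cat (@idx_lt _ _ _ _ _ J) nat_lt x y.
Proof. by case: x y => [x|x] [y|y]. Qed.

Lemma cont_indisc (A : set elt) J c : cont A J c <-> indisc A (cat_seq J c).
Proof. by split; apply: (@indiscernible_sub _ _ _ _ _ _ _ _ id) => x y /idx_lt_cat. Qed.

Lemma idx_trans J (x y z : idx J) : idx_lt x y -> idx_lt y z -> idx_lt x z.
Proof. exact: lt_trans. Qed.

Lemma idx_irr J (x : idx J) : ~ idx_lt x x.
Proof. by rewrite /idx_lt ltxx. Qed.

Lemma idx_tri J (x y : idx J) : [\/ idx_lt x y, x = y | idx_lt y x].
Proof.
by rewrite /idx_lt; case: (ltgtP x y) => h; [constructor 1|constructor 3|constructor 2].
Qed.

Lemma idx_above J (i0 : idx J) : exists u : nat -> idx J,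
  (forall m n, (m < n)%N -> idx_lt (u m) (u n)) /\ forall n, idx_lt i0 (u n).
Proof.
have [next hnext] := choice (@idx_endless _ _ _ _ _ J).
have uS n : idx_lt (iter n next i0) (iter n.+1 next i0) by exact: hnext.
have uinc : {homo (fun n => iter n next i0) : m n / (m < n)%N >-> idx_lt m n}.
  by apply: homo_ltn uS => y x z; exact: idx_trans.
exists (fun n => iter n.+1 next i0); split=> [m n mn|n]; last exact: (uinc 0%N).
exact: (uinc m.+1 n.+1).
Qed.

Lemma idx_chain J : exists u : nat -> idx J,
  forall m n, (m < n)%N -> idx_lt (u m) (u n).
Proof. by have [i0] := idx_inhabited J; have [u [uinc _]] := idx_above i0; exists u. Qed.

Lemma idx_bound J (E : seq (idx J)) i0 : exists i, (i0 <= i)%O /\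
  forall j, j \in E -> idx_lt j i.
Proof.
elim: E => [|j E [i [i0i hi]]]; first by exists i0.
have [k] := idx_endless (Order.max i j); rewrite gt_max => /andP[ik jk].
exists k; split; first exact: (le_trans i0i (ltW ik)).
by move=> j'; rewrite inE => /orP[/eqP ->//|/hi j'i]; exact: idx_trans ik.
Qed.

Lemma seq_end_filter J : ProperFilter (seq_end J).
Proof.
apply: Build_ProperFilter_ex.
  by move=> P [i hi]; exists i; exact: hi.
split.
- by have [i] := idx_inhabited J; exists i => j.
- move=> P Q [i hi] [j hj]; exists (Order.max i j) => k; rewrite ge_max => /andP[ik jk].
  by split; [exact: hi|exact: hj].
- by move=> P Q PQ [i hi]; exists i => j ij; apply/PQ/hi.
Qed.

Lemma is_limE J f v : is_lim J f v <->
  forall e, 0 < e -> exists i, forall j, (i <= j)%O -> dist (pval f (J j)) v <= e.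
Proof.
have FF := seq_end_filter J.
split=> [h e e0|h].
  exact: ((tdist_cvg TL _ v).1 h e e0).
by apply: (tdist_cvg TL _ v).2 => e e0; exact: h.
Qed.

Lemma is_lim_unique J f v w : is_lim J f v -> is_lim J f w -> v = w.
Proof.
move=> /is_limE hv /is_limE hw; apply: tdist_eq => e e0.
have e20 : 0 < e / 2 by rewrite divr_gt0.
have [i hi] := hv _ e20; have [j hj] := hw _ e20.
have := hi (Order.max i j); have := hj (Order.max i j).
rewrite !le_max !lexx orbT => /(_ isT) hj' /(_ isT) hi'.
apply: (le_trans (tdist_tri TL _ (pval f (J (Order.max i j))) _)).
by rewrite tdistC (splitr e) lerD.
Qed.

Lemma is_lim_cst J f v : (forall i, pval f (J i) = v) -> is_lim J f v.
Proof.
move=> h; apply/is_limE => e e0; have [i] := idx_inhabited J.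
by exists i => j _; rewrite h tdistxx ltW.
Qed.

Lemma indisc_sub (A B : set elt) (O : Type) (lt : O -> O -> Prop) (a : O -> tup s) :
  B `<=` A -> indiscernible A lt a -> indiscernible B lt a.
Proof. by move=> BA ia n i j hi hj; apply: (eqtp_sub BA); exact: ia. Qed.

Lemma indisc_em (A : set elt) J : indisc A J ->
  exists Q : emtype s A, realizes Q (@idx_lt _ _ _ _ _ J) J.
Proof. by move=> iJ; have [u uinc] := idx_chain J; exact: indiscernible_realizes iJ uinc. Qed.

(* Increasing sequences far out in [J] approximate [c]. *)
Lemma average_sequence (A : set elt) J f : dependent M K -> small K A ->
  indisc A J -> exists v, is_lim J f v /\
  exists2 c, cont A J c & forall n, pval f (c n) = v.
Proof.
move=> Tdep sA iJ; have [v hv] := Tdep _ _ _ f X_small (indisc_sub (@sub0set _ A) iJ).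
exists v; split=> //; have [Q JQ] := indisc_em iJ.
pose aJ : tup (fun jx : idx J * X => s jx.2) := flat J.
pose B := A `|` (params aJ `|` params (args f)).
have sJX : small K [set: idx J * X].
  by apply: small_prod => //; [exact: monster_lim|exact: idx_small].
have sB : small K B.
  apply: small_setU => //; apply: small_setU; first exact: small_params.
  by apply: small_params; exact: small_ord.
pose T (y : tup (fun nx : nat * X => s nx.2)) (p : (idx J + nat)%type) : tup s :=
  seq_cat J (fun n x => y (n, x)) p.
have [|||||y [yQ yf]] := @indiscernible_saturation A X s B (nat * X)%type
  (fun nx => s nx.2) (idx J + nat)%type (lt_cat (@idx_lt _ _ _ _ _ J) nat_lt) T Q
  nat (fun n y => pval f (fun x => y (n, x))) (fun=> v) sB.
- by move=> c; left.
- by apply: small_prod => //; [exact: monster_lim|exact: small_nat monster_lim].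
- move=> [j|n] x; last by left; exists (n, x), erefl.
  by right; exists (J j x) => //; right; left; exact: (params_at aJ (j, x)).
- move=> n; apply: (@definable_simple B _ _ _ _
    (fun y : tup (fun nx : nat * X => s nx.2) => tapp (fun x => y (n, x)) (args f))).
  move=> [x|i]; first by left; exists (n, x), erefl.
  by right; exists (args f i) => //; right; right; exact: params_at.
- move=> E n i e e0.
  have [i0 hi0] := (is_limE _ _ _).1 hv e e0.
  (* [i1] lies beyond the elements of [J] named in [E] and beyond the place from which [f] is within
     [e] of its limit, so a chain above [i1] can play the continuation. *)
  have [i1 [i01 Ei1]] := idx_bound (pmap (fun p : (idx J + nat)%type =>
    if p is inl j then Some j else None) E) i0.
  have [u [uinc i1u]] := idx_above i1.
  pose h (p : (idx J + nat)%type) := match p with inl j => j | inr n => u n end.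
  exists (flat (fun n => J (u n))); split.
    move=> m j jE jinc g.
    have -> : (fun k => T (flat (fun n => J (u n))) (j k)) = (fun k => J (h (j k))).
      by apply/funext => k; case: (j k).
    apply: JQ => k l kl; have := jinc k l kl; have := jE k; have := jE l.
    case: (j k) (j l) => [jk|nk] [jl|nl] //= jlE jkE; last exact: uinc.
    move=> _; apply: idx_trans (i1u _); apply: Ei1.
    by rewrite mem_pmap; apply/mapP; exists (inl jk).
  by move=> k; apply: (hi0 (u (i k))); apply: (le_trans i01); apply: ltW; exact: i1u.
exists (fun n x => y (n, x)) => //; exact: realizes_indiscernible yQ.
Qed.

(* Unlike [eventually_determines], this also excludes exceptional elements at
   the beginning of a continuation. *)
Definition strongly_determines (A : set elt) J f v :=
  forall D, cont A J D -> pval f (D 0%N) = v.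

(** The splice is a subsequence of [J], [c], [D] put together. Such splices are the competitors in
    the greedy choice of [determination]. *)
Lemma cont_prefix (A : set elt) J c D n : cont A (cat_seq J c) D ->
  cont A J (fun k => if (k < n)%N then c k else D (k - n)%N).
Proof.
move=> ic.
pose h (p : (idx J + nat)%type) : (idx (cat_seq J c) + nat)%type := match p with
  | inl j => inl (inl j)
  | inr k => if (k < n)%N then inl (inr k) else inr (k - n)%N
  end.
have hinc p q : lt_cat (@idx_lt _ _ _ _ _ J) nat_lt p q ->
    lt_cat (@idx_lt _ _ _ _ _ (cat_seq J c)) nat_lt (h p) (h q).
  case: p q => [i|k] [j|l] //=; first by case: (l < n)%N.
  rewrite /nat_lt => kl; case: (ltnP k n) => [kn|nk]; case: (ltnP l n) => [ln|nl] //=.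
    by have := leq_ltn_trans nk (ltn_trans kl ln); rewrite ltnn.
  by rewrite /nat_lt ltn_sub2r // (leq_ltn_trans nk).
have := indiscernible_sub hinc ic.
suff -> : (fun p => seq_cat (cat_seq J c) D (h p)) =
  seq_cat J (fun k => if (k < n)%N then c k else D (k - n)%N) by [].
by apply/funext => -[j|k] //=; case: (k < n)%N.
Qed.

Lemma cont_tail (A : set elt) J c D : cont A (cat_seq J c) D -> cont A J D.
Proof.
move=> h; have := @cont_prefix A J c D 0%N h.
have -> // : (fun k => if (k < 0)%N then c k else D (k - 0)%N) = D.
by apply/funext => k; rewrite ltn0 subn0.
Qed.

(** The supremum may not be attained, but some element exceeds half of it. A zero supremum is
    treated apart, because nothing exceeds half of it then. *)
Lemma approximate_max (S : set R) : S !=set0 -> (forall x, S x -> 0 <= x <= 1) ->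
  exists2 x, S x & forall y, S y -> y <= 2 * x.
Proof.
move=> [x0 Sx0] S01.
have hs : has_sup S by split; [exists x0|exists 1 => x /S01 /andP[]].
have ub y : S y -> y <= sup S by move=> Sy; apply: ub_le_sup => //; case: hs.
have [s0|s0] := leP (sup S) 0.
  exists x0 => // y Sy; apply: (le_trans (ub _ Sy)); apply: (le_trans s0).
  by rewrite mulr_ge0 //; case/andP: (S01 _ Sx0).
have [x Sx hx] := sup_adherent (divr_gt0 s0 (ltr0n R 2)) hs.
by exists x => // y /ub; lra.
Qed.

(* Prolong [J] greedily, the value of [f] at the n-th element moving by at least
   half of what is possible.  These values converge by dependence, so that in the
   limit nothing can move any more. *)
Lemma determination (A : set elt) J f : dependent M K -> small K A ->
  indisc A J -> exists c v, [/\ cont A J c, is_lim (cat_seq J c) f v &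
    strongly_determines A (cat_seq J c) f v].
Proof.
move=> Tdep sA iJ.
have [_ [_ [g0 g0C _]]] := average_sequence f Tdep sA iJ.
pose d n (g g' : nat -> tup s) := dist (pval f (g' n)) (pval f (g n.-1)).
pose cand n (g g' : nat -> tup s) := cont A J g' /\ forall k, (k < n)%N -> g' k = g k.
have step n g : exists g', cont A J g ->
    cand n g g' /\ forall g'', cand n g g'' -> d n g g'' <= 2 * d n g g'.
  have [gC|ngC] := pselect (cont A J g); last by exists g.
  have [||_ [g' hg' <-] hmax] := @approximate_max [set d n g g' | g' in cand n g].
  - by exists (d n g g); exists g.
  - by move=> _ [g' _ <-]; rewrite tdist_ge0 (tdist_le1 TL).
  - by exists g' => _; split=> // g'' hg''; apply: hmax; exists g''.
have {step}[nx hnx] := choice (fun ng : nat * (nat -> tup s) => step ng.1 ng.2).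
pose G := fix G n := if n is m.+1 then nx (m, G m) else g0.
have GC n : cont A J (G n).
  by elim: n => [|n IH] //=; have [[]] := hnx (n, G n) IH.
pose c n := G n.+1 n.
have Gc N k : (k < N)%N -> G N k = c k.
  elim: N => // N IH; rewrite ltnS leq_eqVlt => /orP[/eqP -> //|kN].
  by have [[_ /(_ k kN) /= ->] _] := hnx (N, G N) (GC N); exact: IH.
have cC : cont A J c.
  move=> n i j iinc jinc.
  pose nat_part (p : (idx J + nat)%type) := if p is inr k then k else 0%N.
  (* Indiscernibility concerns finitely many places, and below a suitable [N] the diagonal sequence
     [c] agrees with [G N]. *)
  have [N bd] : exists N, forall k, (maxn (nat_part (i k)) (nat_part (j k)) < N)%N.
    exists (\max_k maxn (nat_part (i k)) (nat_part (j k))).+1 => k; rewrite ltnS.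
    exact: (@leq_bigmax _ (fun k => maxn (nat_part (i k)) (nat_part (j k)))).
  have cG (i' : 'I_n -> (idx J + nat)%type) : (forall k, (nat_part (i' k) < N)%N) ->
      (fun k => seq_cat J c (i' k)) = (fun k => seq_cat J (G N) (i' k)).
    move=> h; apply/funext => k; have := h k; case: (i' k) => //= l lN.
    by rewrite Gc.
  rewrite !cG; first exact: GC.
    by move=> k; have := bd k; rewrite gtn_max => /andP[].
  by move=> k; have := bd k; rewrite gtn_max => /andP[].
have icn : indisc set0 (nat_seq c).
  apply: (indisc_sub (@sub0set _ A)).
  exact: (@indiscernible_sub _ _ _ _ nat _ (@idx_lt _ _ _ _ _ (nat_seq c)) _ inr) cC.
have [v hv] := Tdep _ _ (nat_seq c) f X_small icn.
exists c, v; split=> //.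
  apply/is_limE => e e0; have [i hi] := (is_limE _ _ _).1 hv e e0.
  exists (inr i) => -[j|k] ik; first by rewrite leNgt in ik.
  apply: hi; rewrite leNgt; apply/negP => ki.
  by move: ik; rewrite leNgt => /negP; apply.
move=> D DC; apply: tdist_eq => e e0.
(* [D 0] competes with [c N.+1], hence is within twice [e/5 + e/5] of [c N], which is within [e/5]
   of [v]: five fifths in all. *)
have e50 : 0 < e / 5 by rewrite divr_gt0.
have [N hN] := (is_limE _ _ _).1 hv _ e50.
have hNn m : (N <= m)%N -> dist (pval f (c m)) v <= e / 5 by exact: hN.
have [_ hmax] := hnx (N.+1, G N.+1) (GC N.+1).
have {hmax} := hmax (fun k => if (k < N.+1)%N then c k else D (k - N.+1)%N).
rewrite /cand /d /= ltnn subnn => h.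
have {h} : dist (pval f (D 0%N)) (pval f (c N)) <=
    2 * dist (pval f (c N.+1)) (pval f (c N)).
  apply: h; split; first exact: cont_prefix.
  by move=> k kN; rewrite kN; exact/esym/(Gc N.+1).
have := hNn N (leqnn _); have := hNn N.+1 (leqnSn _).
have := tdist_tri TL (pval f (D 0%N)) (pval f (c N)) v.
have := tdist_tri TL (pval f (c N.+1)) v (pval f (c N)).
rewrite (tdistC TL v (pval f (c N))); lra.
Qed.

End Sequences.

(** * Lascar strong types *)

Section Lascar.
Variables (A : set elt) (A_small : small K A).

Lemma automorphism_over_comp g h :
  automorphism_over A g -> automorphism_over A h ->
  automorphism_over A (fun t (x : car M t) => g t (h t x)).
Proof.
move=> [[gb gt] gA] [[hb ht] hA]; split; last by move=> c Ac; rewrite hA ?gA.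
split=> [t|X s f a]; last by rewrite (gt _ _ f (fun x => h _ (a x))) ht.
exact: bij_comp.
Qed.

Lemma automorphism_over_inv g : automorphism_over A g ->
  exists h, [/\ automorphism_over A h, forall t (x : car M t), h t (g t x) = x &
    forall t (x : car M t), g t (h t x) = x].
Proof.
move=> [[gb gt] gA].
have ex t : exists h, cancel (g t) h /\ cancel h (g t).
  by have [h gh hg] := gb t; exists h.
pose h t := projT1 (cid (ex t)).
have hg t x : h t (g t x) = x by rewrite /h; case: cid => k [].
have gh t x : g t (h t x) = x by rewrite /h; case: cid => k [].
exists h; split=> //; split; last by move=> c Ac; rewrite -{1}(gA c Ac).
split=> [t|X s f a]; first by exists (g t).
rewrite -gt; congr truth_of; apply: functional_extensionality_dep => x; exact: gh.
Qed.

Lemma eqlstp_refl (X : Type) (s : X -> lsort L) (a : tup s) : eqlstp K A a a.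
Proof. by move=> E [Er _ _] _ _; exact: Er. Qed.

Lemma eqlstp_sym (X : Type) (s : X -> lsort L) (a b : tup s) :
  eqlstp K A a b -> eqlstp K A b a.
Proof. by move=> h E Ee Ei Eb; have [_ Es _] := Ee; apply: Es; exact: h. Qed.

Lemma eqlstp_trans (X : Type) (s : X -> lsort L) (a b c : tup s) :
  eqlstp K A a b -> eqlstp K A b c -> eqlstp K A a c.
Proof.
move=> h h' E Ee Ei Eb; have [_ _ Et] := Ee.
by apply: Et (h _ Ee Ei Eb) (h' _ Ee Ei Eb).
Qed.

Lemma eqlstp_automorphism (X : Type) (s : X -> lsort L) (a b : tup s) g :
  automorphism_over A g -> eqlstp K A a b ->
  eqlstp K A (fun x => g _ (a x)) (fun x => g _ (b x)).
Proof. move=> gA h E Ee Ei Eb; exact: Ei gA _ _ (h E Ee Ei Eb). Qed.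

(** A type over [N] is a function from a small set of formulas to a small set of truth values, so
    [K] many tuples cannot all differ in type. *)
Lemma few_types (N : set elt) (X : Type) (s : X -> lsort L) (a : K -> tup s) :
  small K N -> small K [set: X] -> exists k l, k <> l /\ eqtp N (a k) (a l).
Proof.
move=> sN sX.
have : small K [set: formula (sapp s (sset N)) -> truth L].
  apply: small_fun; [exact: monster_lim| |exact: (small_truth TL monster_lim)].
  apply: (small_formula TL monster_lim monster_symbols).
  by apply: small_sum; [exact: monster_lim| |exact: (small_set K N).1].
move=> /smallTE sF; apply: contrapT => no; apply: sF.
exists (fun k f => truth_of f (tapp (a k) (tset N))) => k l e.
apply: contrapT => kl; apply: no; exists k, l; split=> // f.
exact: (congr1 (fun h => h f) e).
Qed.

(* Prolong [t] beyond the number of classes of [E]. *)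
Lemma indiscernible_related (X : Type) (s : X -> lsort L) (E : tup s -> tup s -> Prop)
    (t : nat -> tup s) m n : small K [set: X] ->
  Defs.equiv_rel E -> invariant_rel A E -> bounded_rel K E ->
  indiscernible A nat_lt t -> (m < n)%N -> E (t m) (t n).
Proof.
move=> sX [Er Es Et] Ei Eb it mn.
pose cls := {C : set (tup s) | exists a, C = E a}.
have repr (C : cls) : exists a, sval C = E a by case: C.
have related (C D : cls) a b : sval C = E a -> sval D = E b -> E a b -> C = D.
  move: C D => [C hC] [D hD] /= Ca Db Eab; apply: eq_exist; rewrite Ca Db; apply/funext => c.
  apply/propext; split=> [Eac|Ebc]; last exact: Et Eab Ebc.
  by apply: Et Eac; exact: Es.
have scls : small K [set: cls].
  apply/smallTE => -[f fI]; apply: Eb.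
  have /choice[a ha] k := repr (f k).
  by exists a => k l kl Ekl; apply: kl; apply: fI; exact: related Ekl.
(* The power set of the classes is still small but, by Cantor's theorem, too large for an index set
   along which no class is repeated. *)
have [lt [irr tr tri]] := linear_order_exists {classic (set cls)}.
have [Q tQ] := indiscernible_realizes it (u := id) (fun _ _ h => h).
have [b bQ] : exists b : {classic (set cls)} -> tup s, realizes Q lt b.
  apply: (@realization_exists A X s Q nat nat_lt t id) => //.
  exact: small_powerset monster_lim _ scls.
have [p [q [pq Epq]]] : exists p q, p <> q /\ E (b p) (b q).
  apply: contrapT => no; apply: (@no_embeds_powerset cls).
  exists (fun p => exist (fun C => exists a, C = E a) (E (b p)) (ex_intro _ (b p) erefl)).
  move=> p q [e]; apply: contrapT => pq; apply: no; exists p, q; split=> //.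
  by rewrite e; exact: Er.
wlog lpq : p q pq Epq / lt p q.
  move=> W; have [lpq|//|lqp] := tri p q; first exact: (W p q).
  by apply: (W q p) => //; [move/esym|exact: Es].
pose i (k : 'I_2) := if val k == 0%N then p else q.
pose j (k : 'I_2) := if val k == 0%N then m else n.
have inc (O : Type) (lO : O -> O -> Prop) (x y : O) : lO x y ->
    increasing lO (fun k : 'I_2 => if val k == 0%N then x else y).
  by move=> xy [[|[|//]] hk] [[|[|//]] hl].
(* All increasing pairs have one type over [A], so a single related pair can be carried to [t m],
   [t n]. *)
have ij : eqtp A (flat (fun k => b (i k))) (flat (fun k => t (j k))).
  by move=> f; rewrite (bQ 2 i) ?(tQ 2 j) //; exact: inc.
have s2X : small K [set: 'I_2 * X].
  by apply: small_prod => //; [exact: monster_lim|exact: small_ord].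
have [g gA hg] := homogeneous_over A_small s2X ij.
have := Ei g gA _ _ Epq.
have -> : (fun x => g _ (b p x)) = t m.
  by apply: functional_extensionality_dep => x; exact: (hg (ord0, x)).
have -> // : (fun x => g _ (b q x)) = t n.
by apply: functional_extensionality_dep => x; exact: (hg (ord_max, x)).
Qed.

(** * A small Skolem hull of [A] *)

Section Hull.

Local Notation fstv := (fun p : lsort L * nat => p.1).
Local Notation skolem_formula := (formula (sapp fstv fstv)).

(** Countably many variables of each sort serve all formulas at once. Besides an element of [A], a
    label is a formula together with the sort and the number of the variable whose value in the
    chosen witness is returned. *)
Definition skolem_label : Type := (A + skolem_formula * lsort L * nat)%type.

Definition skolem_witness (f : skolem_formula) (p : nat -> option elt)
    (a : tup fstv) :=
  exists b : tup fstv, truth_of f (tapp a b) = holds /\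
    forall t i (c : car M t), p i = Some (existT _ t c) -> b (t, i) = c.

(* As [K] may be singular, the hull is not obtained as the union of a chain, but
   as the image of a small type of Skolem terms. *)
Fixpoint skolem_eval (w : wtree skolem_label) : option elt :=
  match w with
  | WLeaf => None
  | WNode (inl c) _ => Some (val c)
  | WNode (inr (f, t, k)) ch =>
      match pselect (exists a, skolem_witness f (fun i => skolem_eval (ch i)) a) with
      | left h => Some (existT _ t (projT1 (cid h) (t, k)))
      | right _ => None
      end
  end.

Definition skolem_hull : set elt := [set x | exists w, skolem_eval w = Some x].

Lemma sub_skolem_hull : A `<=` skolem_hull.
Proof. by move=> x Ax; exists (WNode (inl (subset_elt Ax)) (fun=> WLeaf)). Qed.

Lemma small_skolem_hull : small K skolem_hull.
Proof.
apply/small_set.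
have slab : small K [set: skolem_label].
  have Kl := monster_lim; have ssort := small_sort TL monster_symbols.
  have sv : small K [set: lsort L * nat] by apply: small_prod => //; exact: small_nat.
  apply: small_sum => //; first exact: (small_set K A).1.
  apply: small_prod => //; last exact: small_nat.
  apply: small_prod => //; apply: (small_formula TL Kl monster_symbols).
  exact: small_sum.
have ex (x : skolem_hull) : exists w, skolem_eval w = Some (val x) by exact: set_valP x.
have [w hw] := choice ex.
apply: (@small_inj _ _ _ w); last exact: small_wtree monster_lim slab.
move=> x y e; have := hw x; rewrite e hw => -[exy].
by apply/val_inj.
Qed.

(** The Tarski-Vaught property. The parameters are values of terms [w j]; grafting these below a
    node labelled by [f] gives terms for the coordinates of a witness. *)
Lemma skolem_hull_closed m (r : 'I_m -> lsort L) (f : pform M r) :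
  params_in skolem_hull f -> (exists a, pval f a = holds) ->
  exists2 a, inside skolem_hull a & pval f a = holds.
Proof.
move=> fN [a0 ha0]; have /choice[w hw] := fN.
have [l hl] := subst_formula TL (body f).
pose rel (v : 'I_m + 'I_(par f)) (v' : (lsort L * nat) + (lsort L * nat)) :=
  match v, v' with
  | inl i, inl p => p = (r i, val i)
  | inr j, inr p => p = (psort f j, val j)
  | _, _ => False
  end.
have [[i|j] vl|g hg] := hl _ (sapp fstv fstv) rel.
- by exists (inl (r i, val i)).
- by exists (inr (psort f j, val j)).
have {}hg a b : truth_of g (tapp a b) =
    truth_of (body f) (tapp (fun i => a (r i, val i)) (fun j => b (psort f j, val j))).
  by apply: hg => -[i|j] [p|p] e vl //= ep; subst p;
    rewrite (Prop_irrelevance e erefl).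
(* Finite tuples are extended to all the universal variables by default elements, which the formula
   [g] does not see. *)
have ex t : exists x : car M t, True by have [x] := car_inhabited TL M t; exists x.
pose dflt t := projT1 (cid (ex t)).
pose total n (q : 'I_n -> lsort L) (b : tup q) : tup fstv := fun p =>
  match pselect (exists i : 'I_n, (q i, val i) = p) with
  | left h => eq_rect _ (car M) (b (projT1 (cid h))) _ (congr1 fst (projT2 (cid h)))
  | right _ => dflt p.1
  end.
have totalE n (q : 'I_n -> lsort L) (b : tup q) i : total n q b (q i, val i) = b i.
  rewrite /total; case: pselect => [h|[]]; last by exists i.
  case: cid => i' /= e; have ei : i' = i by apply: val_inj; case: e.
  by subst i'; rewrite eq_rect_id.
pose ch k := if insub k is Some j then w j else WLeaf.
have ch_val (j : 'I_(par f)) : skolem_eval (ch (val j)) =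
    Some (existT _ (psort f j) (args f j)).
  by rewrite /ch valK hw.
have hex : exists a, skolem_witness g (fun i => skolem_eval (ch i)) a.
  exists (total _ _ a0), (total _ _ (args f)); split.
    rewrite hg -[RHS]ha0; congr (truth_of _ (tapp _ _));
      by apply: functional_extensionality_dep => i; exact: totalE.
  move=> t i c; rewrite /ch; case: insubP => //= j _ <-; rewrite hw => /Some_inj e.
  have et := projT1_eq e; rewrite /= in et; subst t.
  by rewrite -(existT_inj2 e) totalE.
exists (fun i => projT1 (cid hex) (r i, val i)).
  move=> i; exists (WNode (inr (g, r i, val i)) ch) => /=.
  (* The witness is chosen from a proof of existence; by proof irrelevance all the coordinates
     belong to one and the same tuple. *)
  case: pselect => // h; by rewrite (Prop_irrelevance h hex).
case: cid => a [b [hab hb]] /=; rewrite -hab hg /pval; congr (truth_of _ (tapp _ _)).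
by apply: functional_extensionality_dep => j; rewrite (hb _ _ _ (ch_val j)).
Qed.

End Hull.

Local Notation N := skolem_hull.

Lemma definable_formula (B : set elt) (X : Type) (s : X -> lsort L)
    (F : tup s -> truth L) : definable B F ->
  exists f : formula (sapp s (sset B)), forall d, F d = truth_of f (tapp d (tset B)).
Proof.
move=> [h hB hF]; have [l hl] := subst_formula TL (body h).
pose rel (v : X + 'I_(par h)) (v' : X + B) := match v, v' with
  | inl x, inl x' => x = x'
  | inr j, inr c => val c = existT _ (psort h j) (args h j)
  | _, _ => False
  end.
have [[x|j] vl|g hg] := hl _ (sapp s (sset B)) rel.
- by exists (inl x).
- by exists (inr (subset_elt (hB j))).
exists g => d; rewrite -hF /pval; symmetry; apply: hg => -[x|j] [x'|c] e vl //= ec.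
  by subst x'; rewrite eq_rect_id.
move: e; rewrite /= /sset /tset; case: c ec => x xB /= ec; subst x => e.
by rewrite eq_rect_id.
Qed.

Lemma definable_sub (B C : set elt) (X : Type) (s : X -> lsort L)
    (F : tup s -> truth L) : B `<=` C -> definable B F -> definable C F.
Proof. by move=> BC [h hB hF]; exists h => // i; exact/BC/hB. Qed.

(** The empty conjunction serves as a true formula in both logics. *)
Lemma hull_inhabited t : exists x : car M t, N (existT _ t x).
Proof.
have [g hg] := conj_formula TL (fun i : 'I_0 => False_rect (formula (sapp
  (fun _ : 'I_1 => t) (fun _ : 'I_0 => t))) (notF (ltn_ord i))).
pose f : pform M (fun _ : 'I_1 => t) := @PForm L M _ (fun _ : 'I_1 => t) 0
  (fun _ : 'I_0 => t) g (fun i => False_rect _ (notF (ltn_ord i))).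
have [x] := car_inhabited TL M t.
have [||a aN _] := @skolem_hull_closed _ (fun _ : 'I_1 => t) f.
- by case.
- by exists (fun=> x); apply/hg => -[].
by exists (a ord0); exact: aN.
Qed.

(** The finitely many coordinates that occur in [f] are found by [skolem_hull_closed]; the others
    may be any elements of the hull. *)
Lemma hull_satisfiable (X : Type) (s : X -> lsort L) (c : tup s)
    (f : formula (sapp s (sset N))) : truth_of f (tapp c (tset N)) = holds ->
  exists d, inside N d /\ truth_of f (tapp d (tset N)) = holds.
Proof.
have [|h hN hh] := @definable_simple N _ _ s _ (fun d => tapp d (tset N)) f.
  by apply: simple_tapp => //; exact: simple_id.
rewrite -hh => hc; have [l hl] := subst_formula TL (body h).
pose lx : seq {classic X} := undup (pmap (fun v : {classic X + 'I_(par h)} =>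
  if v is inl x then Some (x : {classic X}) else None) l).
pose xs (i : 'I_(size lx)) : X := tnth (in_tuple lx) i.
have xs_inj : injective xs.
  by move=> i j /= e; have /tuple_uniqP := undup_uniq _ : uniq (in_tuple lx); apply.
pose rel (v : X + 'I_(par h)) (v' : 'I_(size lx) + 'I_(par h)) := match v, v' with
  | inl x, inl i => xs i = x
  | inr j, inr j' => j = j'
  | _, _ => False
  end.
have [[x|j] vl|g hg] := hl _ (sapp (fun i => s (xs i)) (psort h)) rel.
- have xlx : (x : {classic X}) \in lx.
    by rewrite mem_undup mem_pmap; apply/mapP; exists (inl x).
  have /tnthP[i ei] := (xlx : (x : {classic X}) \in in_tuple lx).
  by exists (inl i); rewrite /= /xs ei.
- by exists (inr j).
pose h' := @PForm L M _ (fun i => s (xs i)) (par h) (psort h) g (args h).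
have hh' (a : tup (fun i => s (xs i))) (d : tup s) :
    (forall i, d (xs i) = a i) -> pval h' a = pval h d.
  move=> da; apply: hg => -[x|j] [i|j'] e vl //= ei; last by subst j'; rewrite eq_rect_id.
  by subst x; rewrite eq_rect_id.
have [|a aN ha] := @skolem_hull_closed _ _ h' hN.
  by exists (fun i => c (xs i)); rewrite (hh' _ c).
have ex x : exists dx : car M (s x), N (existT _ (s x) dx) /\
    forall i (e : s (xs i) = s x), xs i = x -> dx = eq_rect _ (car M) (a i) _ e.
  have [[i ei]|no] := pselect (exists i, xs i = x).
    subst x; exists (a i); split=> [|j e /xs_inj ej]; first exact: aN.
    by subst j; rewrite eq_rect_id.
  by have [y yN] := hull_inhabited (s x); exists y; split=> // i e ei; case: no; exists i.
pose d : tup s := fun x => projT1 (cid (ex x)).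
exists d; split; first by move=> x; rewrite /d; case: cid => y [].
rewrite -hh -(hh' a) // => i; rewrite /d; case: cid => y /= [_ /(_ i erefl erefl)].
by [].
Qed.

(** * Coheirs over the hull and their Morley sequences *)

Section Coheir.
Variables (X : Type) (s : X -> lsort L) (X_small : small K [set: X]).
Variables (c : tup s).

(** An ultrafilter containing it is a coheir of the type of [c] over [N]: its average over any set
    is a type finitely satisfiable in [N], up to arbitrarily small errors. *)
Definition coheir_filter : set_system (tup s) := [set W | exists
  f : formula (sapp s (sset N)), truth_of f (tapp c (tset N)) = holds /\
  forall d, inside N d -> truth_of f (tapp d (tset N)) = holds -> W d].

Lemma coheir_proper : ProperFilter coheir_filter.
Proof.
apply: Build_ProperFilter_ex.
  by move=> W [f [/hull_satisfiable[d [dN fd]] hW]]; exists d; exact: hW.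
split.
- have [g hg] := conj_formula TL (fun i : 'I_0 =>
    False_rect (formula (sapp s (sset N))) (notF (ltn_ord i))).
  by exists g; split=> // ; apply/hg => -[].
- move=> V W [f [fc hV]] [g [gc hW]].
  have [h hh] := conj_formula TL (fun i : 'I_2 => if val i == 0%N then f else g).
  exists h; split=> [|d dN /hh hd].
    by apply/hh => -[[|[|//]] hi].
  by split; [apply: hV => //; exact: (hd ord0)|apply: hW => //; exact: (hd ord_max)].
- by move=> V W VW [f [fc hV]]; exists f; split=> // d dN fd; exact/VW/hV.
Qed.

Variables (U : set_system (tup s)) (UU : UltraFilter U) (cU : coheir_filter `<=` U).

Definition ulim (F : tup s -> truth L) v :=
  forall e, 0 < e -> U [set d | dist (F d) v <= e].

Lemma ulim_unique F G v w : ulim F v -> ulim G w -> U [set d | F d = G d] -> v = w.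
Proof.
move=> Fv Gw FG; apply: tdist_eq => e e0.
have e20 : 0 < e / 2 by rewrite divr_gt0.
have [d [[/= dv dw] dFG]] := filter_ex (filterI (filterI (Fv _ e20) (Gw _ e20)) FG).
apply: (le_trans (tdist_tri TL _ (F d) _)).
by rewrite tdistC (splitr e) lerD // dFG.
Qed.

Lemma coheir_inside : U [set d | inside N d].
Proof.
apply: cU; have [g hg] := conj_formula TL (fun i : 'I_0 =>
  False_rect (formula (sapp s (sset N))) (notF (ltn_ord i))).
by exists g; split=> //; apply/hg => -[].
Qed.

(** Over [N] the average is the type of [c] itself, so a Morley sequence may begin with any
    realization of that type. *)
Lemma coheir_ulim F b : eqtp N c b -> definable N F -> ulim F (F b).
Proof.
move=> cb /definable_formula[f hf] e e0; rewrite hf -cb; apply: cU.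
have [g hg] := near_formula TL f (truth_of f (tapp c (tset N))) (ltW e0).
exists g; split=> [|d dN /hg /=]; last by rewrite hf.
by apply/hg; rewrite tdistxx ltW.
Qed.

Lemma coheir_realization (B : set elt) : small K B ->
  exists b, forall F, definable B F -> ulim F (F b).
Proof.
move=> sB; pose I := {h : pform M s | params_in B h}.
have ex (i : I) : exists v, ulim (pval (sval i)) v.
  have [v hv] := ultra_lim TL UU (body (sval i)) (fun d => tapp d (args (sval i))).
  by exists v.
have [v hv] := choice ex.
have [||b hb] := @saturation B X s I (fun i => pval (sval i)) v X_small sB.
- by move=> [h hB]; exists h.
- move=> n i e e0.
  have : U [set d | forall k : 'I_n, dist (pval (sval (i k)) d) (v (i k)) <= e].
    by apply: filter_forall => k; exact: hv.
  exact: filter_ex.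
exists b => F [h hB hF]; have := hv (exist _ h hB); rewrite -hb /=.
by have -> : F = pval h by apply/funext => d; rewrite hF.
Qed.

Definition before (a : nat -> tup s) n : set elt :=
  N `|` [set x | exists2 k, (k < n)%N & params (a k) x].

(** Induction on the length. The last element realizes the average over [N] and the earlier ones, so
    it may be replaced by elements [d] of [N] under a limit along [U]; for such [d], a constant, the
    shorter tuples have the same type over [N] by induction. *)
Lemma morley_indiscernible (a : nat -> tup s) :
  (forall n F, definable (before a n) F -> ulim F (F (a n))) ->
  indiscernible N nat_lt a.
Proof.
move=> aU; elim=> [|n IH] i j iinc jinc.
  have -> // : flat (fun k => a (i k)) = flat (fun k => a (j k)).
  by apply: functional_extensionality_dep => -[[]].
move=> f.
pose T (i : 'I_n.+1 -> nat) (d : tup s) :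
  tup (fun p : 'I_n.+1 * X => s p.2) := flat (fun k =>
    if unlift ord_max k is Some k' then a (i (lift ord_max k')) else d).
pose F i d := truth_of f (tapp (T i d) (tset N)).
have Fa i' : F i' (a (i' ord_max)) = truth_of f (tapp (flat (fun k => a (i' k))) (tset N)).
  rewrite /F /T; congr (truth_of _ (tapp (flat _) _)); apply/funext => k.
  by case: unliftP => [k'|] ->.
have Fdef i' : increasing nat_lt i' -> definable (before a (i' ord_max)) (F i').
  move=> inc; apply: (@definable_simple _ _ _ _ _ (fun d => tapp (T i' d) (tset N))).
  apply: simple_tapp => [x|[k x]]; first by left.
  rewrite /T /flat /=; case: (unliftP ord_max k) => [k' _|_].
    right; exists (a (i' (lift ord_max k')) x) => //; right.
    exists (i' (lift ord_max k')); last exact: params_at.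
    by apply: inc; rewrite lift_max /=.
  by left; exists x, erefl.
rewrite -!Fa; apply: (ulim_unique (aU _ _ (Fdef i iinc)) (aU _ _ (Fdef j jinc))).
apply: filterS coheir_inside => d dN /=.
have inc' (i' : 'I_n.+1 -> nat) : increasing nat_lt i' ->
    increasing nat_lt (fun k => i' (lift ord_max k)).
  by move=> inc k l kl; apply: inc; rewrite !lift_max.
have := @eqtp_map N N _ _ _ (fun p : 'I_n.+1 * X => s p.2)
  (fun (y : tup (fun p : 'I_n * X => s p.2)) => flat (fun k =>
    if unlift ord_max k is Some k' then fun x => y (k', x) else d)) _ _ _ _
  (IH _ _ (inc' i iinc) (inc' j jinc)).
apply=> // -[k x]; rewrite /flat /=; case: (unliftP ord_max k) => [k' _|_].
  by left; exists (k', x), erefl.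
by right; exists (d x) => //; exact: dN.
Qed.

End Coheir.

(* A coheir of the common type of [c] and [c'] has a Morley sequence which
   continues both of them. *)
Lemma hull_eqtp_eqlstp (X : Type) (s : X -> lsort L) (c c' : tup s) :
  small K [set: X] -> eqtp N c c' -> eqlstp K A c c'.
Proof.
move=> sX cc' E Ee Ei Eb; have FF := coheir_proper c.
have [U [UU cU]] := ultraFilterLemma FF.
have av (B : set elt) : exists b, small K B -> forall F, definable B F -> ulim U F (F b).
  have [sB|nB] := pselect (small K B); last by exists c.
  by have [b hb] := coheir_realization sX UU sB; exists b.
have {av}[av hav] := choice av.
(* Both [c] and [c'] are put into [Bs 0], so that the same tail is a Morley sequence after either of
   them. *)
pose Bs := fix Bs n := if n is m.+1 then Bs m `|` params (av (Bs m))
  else N `|` (params c `|` params c').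
have sBs n : small K (Bs n).
  elim: n => [|n IH] /=; last by apply: small_setU => //; exact: small_params.
  apply: small_setU; first exact: small_skolem_hull.
  by apply: small_setU; exact: small_params.
have mono k n : (k <= n)%N -> Bs k `<=` Bs n.
  elim: n => [|n IH]; first by rewrite leqn0 => /eqP ->.
  by rewrite leq_eqVlt => /orP[/eqP -> //|/IH h] x /h; left.
pose sq b n := if n is m.+1 then av (Bs m) else b : tup s.
have sqi b : eqtp N c b -> params b `<=` Bs 0%N -> indiscernible A nat_lt (sq b).
  move=> cb bB; apply: (indisc_sub sub_skolem_hull).
  apply: (@morley_indiscernible _ _ c U UU cU) => -[|n] F Fdef /=.
    apply: (coheir_ulim cU cb); apply: definable_sub Fdef.
    by move=> x [//|[]].
  apply: (hav _ (sBs n)); apply: definable_sub Fdef => x [xN|[[|k] kn xk]].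
  - by apply: (mono 0%N) => //; left.
  - by apply: (mono 0%N) => //; exact: bB.
  - by apply: (mono k.+1 n) => //; right.
have [_ Es Et] := Ee.
apply: (Et _ (av (Bs 0%N))).
  apply: (indiscernible_related (t := sq c) (m := 0%N) (n := 1%N)) => //.
  by apply: sqi => // x h; right; left.
apply: Es; apply: (indiscernible_related (t := sq c') (m := 0%N) (n := 1%N)) => //.
by apply: sqi => // x h; right; right.
Qed.

(** Lascar strong automorphisms, defined by their effect on all small tuples; in this form they are
    visibly closed under composition and conjugation. *)
Definition strong (g : forall t, car M t -> car M t) := automorphism_over A g /\
  forall (X : Type) (s : X -> lsort L) (a : tup s), small K [set: X] ->
    eqlstp K A a (fun x => g _ (a x)).

Definition strong_rel (X : Type) (s : X -> lsort L) (a b : tup s) :=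
  exists2 g, strong g & forall x, g _ (a x) = b x.

Lemma strong_comp g h : strong g -> strong h -> strong (fun t x => g t (h t x)).
Proof.
move=> [gA gS] [hA hS]; split; first exact: automorphism_over_comp.
move=> X s a sX; apply: (eqlstp_trans (hS _ _ a sX)).
exact: (gS _ _ (fun x => h _ (a x))).
Qed.

Lemma strong_rel_equiv (X : Type) (s : X -> lsort L) :
  Defs.equiv_rel (@strong_rel X s).
Proof.
split.
- move=> a; exists (fun t x => x) => //; split; last by move=> *; exact: eqlstp_refl.
  by split=> //; split=> // t; exists id.
- move=> a b [g [gA gS] ab]; have [h [hA hg gh]] := automorphism_over_inv gA.
  exists h => [|x]; last by rewrite -ab hg.
  split=> // Y r d sY; have := eqlstp_sym (gS _ _ (fun y => h _ (d y)) sY).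
  by congr eqlstp; apply: functional_extensionality_dep => y; exact: gh.
- move=> a b d [g gS ab] [h hS bd]; exists (fun t x => h t (g t x)).
    exact: strong_comp.
  by move=> x; rewrite ab bd.
Qed.

Lemma strong_rel_invariant (X : Type) (s : X -> lsort L) :
  invariant_rel A (@strong_rel X s).
Proof.
move=> k kA a b [g [gA gS] ab]; have [h [hA hk kh]] := automorphism_over_inv kA.
exists (fun t x => k t (g t (h t x))) => [|x]; last by rewrite hk ab.
split; first by apply: automorphism_over_comp => //; exact: automorphism_over_comp.
move=> Y r d sY; have := eqlstp_automorphism kA (gS _ _ (fun y => h _ (d y)) sY).
by congr eqlstp; apply: functional_extensionality_dep => y; exact: kh.
Qed.

(** An automorphism fixing the hull is strong, since any small tuple has the same type over the hull
    as its image; and there are few types over the hull. *)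
Lemma strong_rel_bounded (X : Type) (s : X -> lsort L) :
  small K [set: X] -> bounded_rel K (@strong_rel X s).
Proof.
move=> sX [a ha]; have sN := small_skolem_hull.
have [k [l [kl akl]]] := few_types a sN sX.
apply: (ha k l kl); have [g gN gkl] := homogeneous_over sN sX akl.
exists g => //; split.
  by split; [case: gN|move=> x Ax; apply: gN.2; exact: sub_skolem_hull].
move=> Y r b sY; apply: hull_eqtp_eqlstp => //; apply: eqtp_sym.
exact: automorphism_eqtp.
Qed.

(** The orbit relation is one of the bounded invariant equivalence relations, hence coarser than
    equality of Lascar strong types. *)
Lemma eqlstp_strong (X : Type) (s : X -> lsort L) (a b : tup s) :
  small K [set: X] -> eqlstp K A a b -> strong_rel a b.
Proof.
move=> sX; apply; [exact: strong_rel_equiv|exact: strong_rel_invariant|].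
exact: strong_rel_bounded.
Qed.

Lemma indiscernible_strong (X : Type) (s : X -> lsort L) (t : nat -> tup s) m n :
  small K [set: X] -> indiscernible A nat_lt t -> (m < n)%N ->
  strong_rel (t m) (t n).
Proof.
move=> sX it mn; apply: indiscernible_related it mn => //.
- exact: strong_rel_equiv.
- exact: strong_rel_invariant.
- exact: strong_rel_bounded.
Qed.

End Lascar.

(** * Eventual values *)

Section Eventual.
Variables (T_dependent : dependent M K) (A : set elt) (A_small : small K A).
Variables (X : Type) (X_small : small K [set: X]) (s : X -> lsort L).
Implicit Types (J I : eseq M K s) (f : pform M s).

Local Notation ilt J := (@idx_lt _ _ _ _ _ J).
Local Notation unit_lt := (fun _ _ : unit => False).

Lemma realizes_of_sub (Q : emtype s A) (O O' : Type) (lt : O -> O -> Prop)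
    (lt' : O' -> O' -> Prop) (a : O -> tup s) (h : O' -> O) (u : nat -> O') :
  (forall x y, lt' x y -> lt (h x) (h y)) ->
  (forall m n, (m < n)%N -> lt' (u m) (u n)) ->
  indiscernible A lt a -> realizes Q lt' (fun x => a (h x)) -> realizes Q lt a.
Proof.
move=> hinc uinc ia aQ n i iinc f.
rewrite -(aQ n (fun k => u k)); last by move=> k l; exact: uinc.
by apply: ia => // k l kl; apply/hinc/uinc.
Qed.

Lemma realizes_cat (Q : emtype s A) (P : Type) (ltP : P -> P -> Prop) J
    (a : idx J -> tup s) (b : P -> tup s) :
  realizes Q (ilt J) a -> indiscernible A (lt_cat (ilt J) ltP) (seq_cat a b) ->
  realizes Q (lt_cat (ilt J) ltP) (seq_cat a b).
Proof.
move=> aQ iab; have [u uinc] := idx_chain J.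
exact: (realizes_of_sub (h := inl) (lt' := ilt J) (u := u)) iab aQ.
Qed.

Lemma is_lim_cat J c f v : is_lim (cat_seq J c) f v -> is_lim (nat_seq c) f v.
Proof.
move=> /is_limE h; apply/is_limE => e e0; have [[i|n] hi] := h e e0.
  by exists 0%N => j _; apply: (hi (inr j)); rewrite leNgt.
exists n => j nj; apply: (hi (inr j)); rewrite leNgt; apply/negP => jn.
by move: nj; rewrite leNgt => /negP; apply.
Qed.

(** The element at [i] begins an increasing subsequence of [J'] of type omega, which continues
    [J]. *)
Lemma strongly_determines_at J f v J' i : strongly_determines A J f v ->
  continues A J J' -> pval f (J' i) = v.
Proof.
move=> Jf JJ'; have [u [uinc iu]] := idx_above i.
pose w n := if n is m.+1 then u m else i.
have winc m n : (m < n)%N -> idx_lt (w m) (w n).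
  by case: m n => [|m] [|n] //= mn; first [exact: iu|exact: uinc].
apply: (Jf (fun n => J' (w n))).
rewrite /cont.
have -> : seq_cat J (fun n => J' (w n)) = (fun p : (idx J + nat)%type =>
    seq_cat J J' (match p with inl j => inl j | inr n => inr (w n) end)).
  by apply/funext => -[].
apply: indiscernible_sub JJ' => -[j|m] [l|n] //=; exact: winc.
Qed.

Lemma strongly_determines_eventually J f v : strongly_determines A J f v ->
  forall J', continues A J J' -> is_lim J' f v.
Proof. by move=> Jf J' JJ'; apply: is_lim_cst => i; exact: strongly_determines_at JJ'. Qed.

Lemma strongly_determines_cat J f v c : strongly_determines A J f v ->
  strongly_determines A (cat_seq J c) f v.
Proof. by move=> Jf D /cont_tail; exact: Jf. Qed.

Lemma cont_continues J c : cont A J c -> continues A J (nat_seq c).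
Proof.
apply: (@indiscernible_sub _ _ _ _ _ _ _ _ id) => -[i|m] [j|n] //=.
Qed.

Definition map_seq (g : forall t, car M t -> car M t) J : eseq M K s :=
  @ESeq L M K X s _ (idx J) (@idx_small _ _ _ _ _ J) (@idx_inhabited _ _ _ _ _ J)
    (@idx_endless _ _ _ _ _ J) (fun i x => g _ (J i x)).

Lemma indiscernible_map (O : Type) (lt : O -> O -> Prop) (a : O -> tup s) g :
  automorphism_over A g -> indiscernible A lt a ->
  indiscernible A lt (fun o x => g _ (a o x)).
Proof.
move=> gA ia n i j iinc jinc.
apply: (eqtp_trans (automorphism_eqtp (flat (fun k => a (i k))) gA)).
apply: (eqtp_trans (ia n i j iinc jinc)); apply: eqtp_sym.
exact: (automorphism_eqtp (flat (fun k => a (j k))) gA).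
Qed.

(** * Eventual values for an abstract class [JJ] of sequences *)

Section Class.
Variables (Q : emtype s A) (JJ : eseq M K s -> Prop).
Hypothesis JJ_realizes : forall J, JJ J -> realizes Q (ilt J) J.
Hypothesis JJ_cat : forall J c, JJ J -> cont A J c -> JJ (cat_seq J c).
Hypothesis JJ_nonempty : exists J, JJ J.
Hypothesis JJ_amalgam : forall J1 J2, JJ J1 -> JJ J2 -> exists c,
  indisc_snoc A J1 c /\ indisc_snoc A J2 c.

Definition eventual_set f : set (truth L) := [set v | exists J,
  [/\ JJ J, eventually_determines A J f & is_lim J f v]].

Definition eventual f : truth L := xget holds (eventual_set f).

Lemma JJ_indisc J : JJ J -> indisc A J.
Proof. by move=> /JJ_realizes; exact: realizes_indiscernible. Qed.

(** Speciality gives a single further element only. The Ehrenfeucht-Mostowski type allows to prolong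
    it to a continuation beginning with [c], and the first element of a continuation has the
    determined value. *)
Lemma snoc_value J f v c : JJ J -> strongly_determines A J f v ->
  indisc_snoc A J c -> pval f c = v.
Proof.
move=> JJJ Jf Jc.
have JcQ := realizes_cat (JJ_realizes JJJ) Jc.
have [u uinc] := idx_chain J.
have [||||||||b bQ hb] := @extension A X s Q _ _ _ (fun n => inl (u n))
  (idx J + nat)%type (lt_cat (ilt J) nat_lt)
  (fun p => match p with inl j => inl j | inr _ => inr 0%N end)
  A_small X_small _ _ JcQ.
- exact: small_ocat.
- apply: small_sum; [exact: monster_lim|exact: idx_small|].
  apply: (@small_inj _ _ _ (fun _ : unit => 0%N)); last exact: small_nat monster_lim.
  by move=> [] [].
- by move=> m n mn; exact: uinc.
- by move=> [x|[]] [y|[]] [z|[]] //=; exact: idx_trans.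
- move=> [x|[]] [y|[]] /=; [|by constructor 1|by constructor 3|by constructor 2].
  by have [h|->|h] := idx_tri x y; [constructor 1|constructor 2|constructor 3].
- by move=> [x|n] /=; [exact: idx_irr|rewrite /nat_lt ltnn].
- by move=> [x|n] [y|m] [z|p] //=; [exact: idx_trans|exact: ltn_trans].
- by move=> [x|[]] [y|[]].
have <- : b (inr 0%N) = c by exact: (hb (inr tt)).
apply: (Jf (fun n => b (inr n))); rewrite /cont.
have -> : seq_cat J (fun n => b (inr n)) = b.
  by apply/funext => -[j|n] //; exact/esym/(hb (inl j)).
exact: realizes_indiscernible bQ.
Qed.

Lemma determined_unique J1 J2 f v1 v2 : JJ J1 -> JJ J2 ->
  strongly_determines A J1 f v1 -> strongly_determines A J2 f v2 -> v1 = v2.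
Proof.
move=> h1 h2 d1 d2; have [c [c1 c2]] := JJ_amalgam h1 h2.
by rewrite -(snoc_value h1 d1 c1) -(snoc_value h2 d2 c2).
Qed.

Lemma strongly_determines_is_lim J f v : JJ J -> strongly_determines A J f v ->
  is_lim J f v.
Proof.
move=> /JJ_indisc iJ Jf.
have [w [Jw [c Jc cw]]] := average_sequence X_small f T_dependent A_small iJ.
by rewrite -(Jf c Jc) cw.
Qed.

(** Bridge from the weaker notion in the definition. The value which [J'] determines is its own
    limit, as an average continuation shows, and also the value of a strongly determining
    continuation of [J']. *)
Lemma eventual_set_determined J f v w : JJ J -> strongly_determines A J f v ->
  eventual_set f w -> w = v.
Proof.
move=> JJJ Jf [J' [JJ' [v0 Jv0] J'w]]; have iJ' := JJ_indisc JJ'.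
have [w' [J'w' [c J'c cw]]] := average_sequence X_small f T_dependent A_small iJ'.
have ww' := is_lim_unique J'w J'w'; subst w'.
have v0w := is_lim_unique (Jv0 _ (cont_continues J'c)) (is_lim_cst (J := nat_seq c) cw).
have [d [v' [J'd dv' Jd]]] := determination X_small f T_dependent A_small iJ'.
have v0v' := is_lim_unique (Jv0 _ (cont_continues J'd)) (is_lim_cat dv').
rewrite -v0w v0v'; apply: (determined_unique _ JJJ Jd Jf); exact: JJ_cat.
Qed.

Lemma eventualE J f v : JJ J -> strongly_determines A J f v -> eventual f = v.
Proof.
move=> JJJ Jf; apply: (eventual_set_determined JJJ Jf).
rewrite /eventual; apply: xgetPex; exists v, J; split=> //.
  by exists v; exact: strongly_determines_eventually.
exact: strongly_determines_is_lim.
Qed.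

Lemma JJ_determination J f : JJ J -> exists c v, [/\ cont A J c,
  JJ (cat_seq J c) & strongly_determines A (cat_seq J c) f v].
Proof.
move=> JJJ; have [c [v [Jc _ cv]]] :=
  determination X_small f T_dependent A_small (JJ_indisc JJJ).
by exists c, v; split=> //; exact: JJ_cat.
Qed.

Lemma JJ_finite_determination n (f : 'I_n -> pform M s) : exists2 J, JJ J &
  forall i, strongly_determines A J (f i) (eventual (f i)).
Proof.
elim: n f => [|n IH] f; first by have [J JJJ] := JJ_nonempty; exists J => // -[].
have [J JJJ Jf] := IH (fun i => f (lift ord0 i)).
have [c [v [Jc JJc cv]]] := JJ_determination (f ord0) JJJ.
exists (cat_seq J c) => // i; have [j ->|->] := unliftP ord0 i.
  exact: strongly_determines_cat.
by rewrite (eventualE JJc cv).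
Qed.

Lemma eventual_finitely_realized n (f : 'I_n -> pform M s) :
  exists a, forall i, pval (f i) a = eventual (f i).
Proof.
have [J JJJ Jf] := JJ_finite_determination f.
(* A continuation is obtained by averaging some formula; when there are no formulas any element will
   do. *)
case: n f Jf => [|n] f Jf; first by have [i] := idx_inhabited J; exists (J i) => -[].
have [w [_ [c Jc _]]] :=
  average_sequence X_small (f ord0) T_dependent A_small (JJ_indisc JJJ).
by exists (c 0%N) => i; exact: Jf.
Qed.

Lemma eventual_realized (B : set elt) : small K B ->
  exists a, forall f, params_in B f -> pval f a = eventual f.
Proof.
move=> sB.
have [||a ha] := @saturation B X s {f : pform M s | params_in B f}
  (fun h => pval (sval h)) (fun h => eventual (sval h)) X_small sB.
- by move=> [f fB]; exists f.
- move=> n i e e0.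
  have [a ha] := eventual_finitely_realized (fun k => sval (i k)).
  by exists a => k; rewrite ha tdistxx ltW.
by exists a => f fB; exact: (ha (exist _ f fB)).
Qed.

Lemma eventual_complete (C : set elt) :
  complete_type (fun h : form_over s C => eventual (sval h)).
Proof. by move=> n f; exact: (eventual_finitely_realized (fun i => sval (f i))). Qed.

(** If [J] determines the formula with parameters [b], then its image under [g] determines the one
    with the image parameters, to the same value: continuations are pulled back by the inverse of
    [g]. *)
Lemma eventual_automorphism n (q : 'I_n -> lsort L) (f : formula (sapp s q))
    (b : tup q) g : automorphism_over A g -> (forall J, JJ J -> JJ (map_seq g J)) ->
  eventual (PForm f (fun i => g _ (b i))) = eventual (PForm f b).
Proof.
move=> gA gJJ.
have [J JJJ Jf] := JJ_finite_determination (fun _ : 'I_1 => PForm f b).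
have [h [hA hg gh]] := automorphism_over_inv gA.
apply: (eventualE (gJJ _ JJJ)) => D DC; rewrite -(Jf ord0 (fun n x => h _ (D n x))).
  rewrite /pval /= -[RHS]gA.1.2; congr truth_of.
  by apply: functional_extensionality_dep => -[x|i] //=; rewrite gh.
have := indiscernible_map hA DC; rewrite /cont.
have -> // : (fun o x => h _ (seq_cat (map_seq g J) D o x)) =
  seq_cat J (fun n x => h _ (D n x)).
apply/funext => -[j|m] //=.
by apply: functional_extensionality_dep => x; rewrite hg.
Qed.

(* A dividing formula holding eventually would hold eventually along the whole
   indiscernible sequence, strong automorphisms being transitive on it. *)
Lemma eventual_does_not_fork (C : set elt) :
  (forall g J, strong A g -> JJ J -> JJ (map_seq g J)) ->
  ~ forks K A (fun f : form_over s C => eventual (sval f)).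
Proof.
move=> JJ_strong [C0 [n [f [C0C sC0 fdiv fimp]]]].
(* The dividing formulas may have parameters outside [C]. With these included in [B], the formula
   satisfied by the realization [a] holds eventually as well. *)
pose B := C0 `|` range (fun p : {i : 'I_n & 'I_(par (f i))} =>
  existT _ _ (args (f (projT1 p)) (projT2 p))).
have sB : small K B.
  apply: small_setU => //; apply: small_range.
  apply: (@small_sigT K monster_lim _ nat _ (fun i (j : 'I_(par (f i))) => val j)).
  - exact: small_ord.
  - exact: (small_nat monster_lim).
  - by move=> i; exact: val_inj.
have [a ha] := eventual_realized sB.
have [|i fia] := fimp a.
  by move=> g gC0; apply: ha => j; left; exact: gC0.
have evi : eventual (f i) = holds.
  by rewrite -fia; symmetry; apply: ha => j; right; exists (existT _ i j).
have [b [b0 bind []]] := fdiv i.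
have ev m : eventual (PForm (body (f i)) (b m)) = holds.
  have e0 : PForm (body (f i)) (b 0%N) = f i by rewrite b0; case: (f i).
  case: m => [|m]; first by rewrite e0.
  have [g gS gb] := indiscernible_strong A_small (@small_ord _) bind (ltn0Sn m).
  have -> : b m.+1 = fun j => g _ (b 0%N j).
    by apply: functional_extensionality_dep => j; rewrite gb.
  rewrite eventual_automorphism ?e0 //; first by case: gS.
  by move=> J; exact: JJ_strong.
have [|d hd] := @eventual_realized (range (fun p : nat * 'I_(par (f i)) =>
    existT _ _ (b p.1 p.2))).
  apply: small_range; apply: small_prod; [exact: monster_lim| |exact: small_ord].
  exact: (small_nat monster_lim).
exists d => m; have := hd (PForm (body (f i)) (b m)); rewrite ev; apply.
by move=> j; exists (m, j).
Qed.

End Class.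

(** Speciality of [I] is about sequences indexed like [I], whereas the class contains other order
    types. Only finite pieces of [J] are therefore located in sequences of the former kind. *)
Definition locally_ok I (okI : (idx I -> tup s) -> Prop) J :=
  forall n (i : 'I_n -> idx J), increasing (ilt J) i ->
  exists (I0 : idx I -> tup s) o, [/\ okI I0, increasing (ilt I) o & forall k, I0 (o k) = J (i k)].

Lemma locally_ok_snoc (Q : emtype s A) I (okI : (idx I -> tup s) -> Prop) J
    (E : seq (idx J)) :
  (forall I0 : idx I -> tup s, okI I0 -> realizes Q (ilt I) I0) -> locally_ok okI J ->
  exists2 I0 : idx I -> tup s, okI I0 & forall c, indisc_snoc A I0 c ->
    forall m (j : 'I_m -> idx J + unit),
    (forall k x, j k = inl x -> x \in E) -> increasing (lt_cat (ilt J) unit_lt) j ->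
    forall g, truth_of g (tapp (flat (fun k => seq_cat J (fun=> c) (j k))) (tset A)) =
      Q m g.
Proof.
move=> okQ okJ.
have [n [w [winc wE]]] := @finite_chain _ _ (ilt J) id E (@idx_trans _ _ J) (@idx_tri _ _ J).
have [I0 [p [okI0 oinc oJ]]] := okJ n w winc.
exists I0 => // c cI m j jE jinc f.
have cQ := realizes_cat (okQ _ okI0) cI.
pose rel (x : idx J + unit) (y : idx I + unit) := match x, y with
  | inl x, inl y => exists2 k, w k = x & y = p k
  | inr _, inr _ => True
  | _, _ => False
  end.
have ex k : exists y, rel (j k) y.
  case jk : (j k) => [x|[]]; last by exists (inr tt).
  have xE : (x : {classic idx J}) \in (E : seq {classic idx J}).
    by rewrite mem_classic; exact: jE jk.
  by have [l wl] := wE x xE; exists (inl (p l)), l.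
have [h hh] := choice ex.
have -> : (fun k => seq_cat J (fun=> c) (j k)) = (fun k => seq_cat I0 (fun=> c) (h k)).
  apply/funext => k; have := hh k; case: (j k) (h k) => [x|?] [y|?] //= [l <- ->].
  by rewrite oJ.
apply: cQ => k l kl; have := jinc k l kl; have := hh k; have := hh l.
case: (j k) (h k) (j l) (h l) => [x|?] [y|?] [x'|?] [y'|?] //=.
move=> [k1 <- ->] [k2 <- ->]; rewrite /= => qp; apply: oinc.
case: (ltngtP k2 k1) => // [pq|/val_inj pq].
  by have := idx_trans qp (winc _ _ pq) => /idx_irr.
by move: qp; rewrite pq => /idx_irr.
Qed.

Lemma amalgamation (Q : emtype s A) I (okI : (idx I -> tup s) -> Prop) J1 J2 :
  (forall I0 : idx I -> tup s, okI I0 -> realizes Q (ilt I) I0) ->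
  (forall I1 I2 : idx I -> tup s, okI I1 -> okI I2 -> exists c,
     indisc_snoc A I1 c /\ indisc_snoc A I2 c) ->
  locally_ok okI J1 -> locally_ok okI J2 ->
  exists c, indisc_snoc A J1 c /\ indisc_snoc A J2 c.
Proof.
move=> okQ okI_special ok1 ok2.
pose P := ((idx J1 + unit) + (idx J2 + unit))%type.
(* The two summands are not related, so that an indiscernible family on [P] is
   a pair of indiscernible sequences. *)
pose ltP (p q : P) := match p, q with
  | inl x, inl y => lt_cat (ilt J1) unit_lt x y
  | inr x, inr y => lt_cat (ilt J2) unit_lt x y
  | _, _ => False
  end.
pose T (c : tup s) (p : P) := match p with
  | inl x => seq_cat J1 (fun=> c) x
  | inr x => seq_cat J2 (fun=> c) x
  end.
pose B := A `|` (params (flat J1) `|` params (flat J2)).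
have sJ J : small K (params (flat J)).
  apply: small_params; apply: small_prod => //; [exact: monster_lim|exact: idx_small].
have sB : small K B by apply: small_setU => //; exact: small_setU.
have [|||||c [cQ _]] := @indiscernible_saturation A X s B X s P ltP T Q void
  (fun v _ => match v with end) (fun v => match v with end) sB.
- by move=> x; left.
- exact: X_small.
- move=> [[j|[]]|[j|[]]] x; try by left; exists x, erefl.
    right; exists (J1 j x) => //; right; left; exact: (params_at (flat J1) (j, x)).
  right; exists (J2 j x) => //; right; right; exact: (params_at (flat J2) (j, x)).
- by case.
- move=> E n i e e0.
  pose E1 := pmap (fun p : P => if p is inl (inl j) then Some j else None) E.
  pose E2 := pmap (fun p : P => if p is inr (inl j) then Some j else None) E.
  have [I1 okI1 h1] := locally_ok_snoc E1 okQ ok1.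
  have [I2 okI2 h2] := locally_ok_snoc E2 okQ ok2.
  have [c [c1 c2]] := okI_special _ _ okI1 okI2.
  exists c; split; last by move=> k; case: (i k).
  move=> m j jE jinc f.
  (* Elements of different summands are unrelated, so an increasing tuple stays in the summand of
     its first element; the empty tuple is assigned to the left. *)
  have [side|side] : (forall k, exists x, j k = inl x) \/ (forall k, exists x, j k = inr x).
    case: m j jE jinc f => [|m] j jE jinc f; first by left => -[].
    have jk k : k = ord0 \/ ltP (j ord0) (j k).
      by have [->|k0] := eqVneq k ord0; [left|right; apply: jinc; rewrite lt0n].
    case j0 : (j ord0) => [x|x]; [left|right] => k;
      by have [->|] := jk k; [exists x|rewrite j0; case: (j k) => // y _; exists y].
  + have [j1 hj1] := choice side.
    have -> : (fun k => T c (j k)) = (fun k => seq_cat J1 (fun=> c) (j1 k)).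
      by apply/funext => k; rewrite hj1.
    apply: h1 => // [k x jkx|k l kl]; last by have := jinc k l kl; rewrite !hj1.
    rewrite mem_pmap; apply/mapP; exists (inl (inl x)) => //.
    by rewrite -jkx -hj1.
  + have [j1 hj1] := choice side.
    have -> : (fun k => T c (j k)) = (fun k => seq_cat J2 (fun=> c) (j1 k)).
      by apply/funext => k; rewrite hj1.
    apply: h2 => // [k x jkx|k l kl]; last by have := jinc k l kl; rewrite !hj1.
    rewrite mem_pmap; apply/mapP; exists (inr (inl x)) => //.
    by rewrite -jkx -hj1.
have cP := realizes_indiscernible cQ.
exists c; split.
  exact: (@indiscernible_sub _ _ _ _ _ ltP (lt_cat (ilt J1) unit_lt) (T c) inl).
exact: (@indiscernible_sub _ _ _ _ _ ltP (lt_cat (ilt J2) unit_lt) (T c) inr).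
Qed.

(** Any increasing choice of blocks lists its elements in lexicographic order, so two choices have
    the same order pattern in [J]. *)
Lemma block_indiscernible J n (w : nat -> 'I_n -> idx J) : indisc A J ->
  (forall m, increasing (ilt J) (w m)) ->
  (forall m m' k k', (m < m')%N -> ilt J (w m k) (w m' k')) ->
  @indiscernible _ _ A nat nat_lt _ (fun p : 'I_n * X => s p.2)
    (fun m => flat (fun k => J (w m k))).
Proof.
move=> iJ winc wlt; have [Q JQ] := indisc_em iJ => N i j iinc jinc.
pose lex (z z' : 'I_N * 'I_n) := (z.1 < z'.1)%N || ((z.1 == z'.1) && (z.2 < z'.2)%N).
have lex_total z z' : [\/ lex z z', z = z' | lex z' z].
  case: z z' => [z1 z2] [z1' z2']; rewrite /lex /= (eq_sym z1').
  case: (ltngtP z1 z1') => [||/val_inj ->]; [by constructor 1|by constructor 3|].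
  rewrite eqxx /=; case: (ltngtP z2 z2') => [||/val_inj ->];
    [by constructor 1|by constructor 3|by constructor 2].
have lex_lt (i' : 'I_N -> nat) z z' : increasing nat_lt i' -> lex z z' ->
    ilt J (w (i' z.1) z.2) (w (i' z'.1) z'.2).
  move=> inc /orP[zz|/andP[/eqP -> zz]]; [exact/wlt/inc|exact: winc].
have lt_lex (i' : 'I_N -> nat) z z' : increasing nat_lt i' ->
    ilt J (w (i' z.1) z.2) (w (i' z'.1) z'.2) -> lex z z'.
  move=> inc lt; case: (lex_total z z') => // [e|/(lex_lt _ _ _ inc)].
    by rewrite e in lt; case: (idx_irr lt).
  by move=> /(idx_trans lt) /idx_irr.
have eq_lex (i' : 'I_N -> nat) z z' : increasing nat_lt i' ->
    w (i' z.1) z.2 = w (i' z'.1) z'.2 -> z = z'.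
  move=> inc e; case: (lex_total z z') => // /(lex_lt _ _ _ inc);
    by rewrite e => /idx_irr.
have := @realizes_eqtp A X s Q ('I_N * 'I_n) _ _ (ilt J) (ilt J) J J
  (fun z => w (i z.1) z.2) (fun z => w (j z.1) z.2) (@idx_trans _ _ J) (@idx_tri _ _ J) JQ JQ.
move=> /(_ (fun z z' h => lex_lt _ _ _ jinc (lt_lex _ _ _ iinc h))).
move=> /(_ (fun z z' h => congr1 (fun z => w (j z.1) z.2) (eq_lex _ _ _ iinc h))).
pose T (y : tup (fun p : ('I_N * 'I_n) * X => s p.2)) :
  tup (fun p : 'I_N * ('I_n * X) => s p.2.2) := fun p => y ((p.1, p.2.1), p.2.2).
by apply: (@eqtp_map A A _ _ _ _ T) => // p; left; exists ((p.1, p.2.1), p.2.2), erefl.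
Qed.

(** Two interleaved tuples need not start a common sequence of blocks. Each is compared instead with
    one block lying above both, being followed by consecutive blocks of length [n] along [u]. *)
Lemma increasing_strong J n (i j : 'I_n -> idx J) : indisc A J ->
  increasing (ilt J) i -> increasing (ilt J) j ->
  @strong_rel A _ (fun p : 'I_n * X => s p.2)
    (flat (fun k => J (i k))) (flat (fun k => J (j k))).
Proof.
move=> iJ iinc jinc; have [i0] := idx_inhabited J.
have [top [_ htop]] := idx_bound ([seq i k | k : 'I_n] ++ [seq j k | k : 'I_n]) i0.
have [u [uinc topu]] := idx_above top.
pose w (i' : 'I_n -> idx J) m (k : 'I_n) := if m is m'.+1 then u (m' * n + k)%N else i' k.
have toblock (i' : 'I_n -> idx J) : increasing (ilt J) i' ->
    (forall k, idx_lt (i' k) top) ->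
    @strong_rel A _ (fun p : 'I_n * X => s p.2)
      (flat (fun k => J (i' k))) (flat (fun k : 'I_n => J (u k))).
  move=> i'inc i'top.
  have sn : small K [set: 'I_n * X].
    by apply: small_prod => //; [exact: monster_lim|exact: small_ord].
  have iw : @indiscernible _ _ A nat nat_lt _ (fun p : 'I_n * X => s p.2)
      (fun m => flat (fun k => J (w i' m k))).
    apply: block_indiscernible => // [[|m] k l kl|[|m] [|m'] k l mm'] //=.
    - exact: i'inc.
    - by apply: uinc; rewrite ltn_add2l.
    - exact: idx_trans (i'top k) (topu _).
    - apply: uinc; apply: (@leq_trans (m.+1 * n)%N).
        by rewrite mulSn addnC ltn_add2r ltn_ord.
      by apply: leq_trans (leq_addr _ _); rewrite leq_mul2r -ltnS mm' orbT.
  exact: (indiscernible_strong A_small sn iw (ltnSn 0)).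
have [_ Es Et] := strong_rel_equiv A (fun p : 'I_n * X => s p.2).
apply: Et (toblock i _ _) (Es _ _ (toblock j _ _)) => // k; apply: htop;
  by rewrite mem_cat map_f ?orbT // mem_enum.
Qed.

Lemma realizes_cat_seq (Q : emtype s A) J c : realizes Q (ilt J) J ->
  cont A J c -> realizes Q (ilt (cat_seq J c)) (cat_seq J c).
Proof.
move=> JQ Jc; apply: (@realizes_sub A _ s Q _ _ _ _ _ id) (realizes_cat JQ Jc).
by move=> x y /idx_lt_cat.
Qed.

Lemma small_flat J : small K [set: idx J * X].
Proof. by apply: small_prod => //; [exact: monster_lim|exact: idx_small]. Qed.

(** * The class of a Lascar special sequence *)

Section LascarClass.
Variables (I : eseq M K s) (I_special : lascar_special A I).

Let JJ J := eqlstp_seq A J I /\ indisc A J.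
Let okI (a : idx I -> tup s) := eqlstp K A (flat a) (flat I).

Let small_natX : small K [set: nat * X].
Proof. by apply: small_prod => //; [exact: monster_lim|exact: (small_nat monster_lim)]. Qed.

Lemma lascar_ok_realizes (Q : emtype s A) a :
  realizes Q (ilt I) I -> okI a -> realizes Q (ilt I) a.
Proof.
move=> IQ /eqlstp_sym /(eqlstp_strong A_small (@small_flat I)) [g [gA _] hg].
have -> : a = (fun i x => g _ (I i x)).
  apply/funext => i; apply: functional_extensionality_dep => x; exact/esym/(hg (i, x)).
exact: realizes_automorphism.
Qed.

Lemma lascar_class_realizes (Q : emtype s A) J :
  realizes Q (ilt I) I -> JJ J -> realizes Q (ilt J) J.
Proof.
move=> IQ [[u [v [uinc vinc]]] /eqlstp_sym uv iJ].
have [g [gA _] hg] := eqlstp_strong A_small small_natX uv.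
apply: (@realizes_of_sub Q _ _ _ nat_lt _ u id) => //.
have -> : (fun n => J (u n)) = (fun n x => g _ (I (v n) x)).
  apply/funext => n; apply: functional_extensionality_dep => x; exact/esym/(hg (n, x)).
by apply: realizes_automorphism => //; exact: realizes_sub IQ.
Qed.

Lemma lascar_class_cat J c : JJ J -> cont A J c -> JJ (cat_seq J c).
Proof.
move=> [[u [v [uinc vinc uv]]] iJ] Jc; split; last exact/cont_indisc.
by exists (fun n => inl (u n)), v; split=> // m n; exact: uinc.
Qed.

Lemma lascar_class_strong g J : strong A g -> JJ J -> JJ (map_seq g J).
Proof.
move=> [gA gS] [[u [v [uinc vinc uv]]] iJ]; split; last exact: indiscernible_map.
exists u, v; split=> //; apply: eqlstp_trans uv; apply: eqlstp_sym.
exact: gS small_natX.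
Qed.

(** One strong automorphism carries a subsequence of [I] to one of [J], a second moves the first [n]
    terms of the latter to the required places. Their composition preserves the Lascar strong type
    of all of [I]. *)
Lemma lascar_class_locally_ok J : JJ J -> locally_ok okI J.
Proof.
move=> [[u [v [uinc vinc]]] /eqlstp_sym uv iJ] n i iinc.
have [g gS hg] := eqlstp_strong A_small small_natX uv.
have [h hS hh] := increasing_strong iJ (fun k l kl => uinc k l kl) iinc.
exists (fun j x => h _ (g _ (I j x))), (fun k => v k); split.
- apply: eqlstp_sym; exact: ((strong_comp hS gS).2 _ _ _ (@small_flat I)).
- by move=> k l; exact: vinc.
- move=> k; apply: functional_extensionality_dep => x.
  by rewrite -[RHS](hh (k, x)); congr (h _ _); exact: (hg (val k, x)).
Qed.

Lemma lascar_eventual (C : set elt) :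
  ev_lascar A I C = (fun h : form_over s C => eventual JJ (sval h)).
Proof.
apply/funext => h; congr (xget holds _); apply/seteqP; split=> v [J].
  by move=> [J1 J2 J3 J4]; exists J.
by move=> [[J1 J2] J3 J4]; exists J.
Qed.

Lemma lascar_special_eventual (C : set elt) :
  complete_type (ev_lascar A I C) /\ ~ forks K A (ev_lascar A I C).
Proof.
have [iI spI] := I_special; have [Q IQ] := indisc_em iI.
have real J : JJ J -> realizes Q (ilt J) J := lascar_class_realizes IQ.
have nonempty : exists J, JJ J.
  have [u uinc] := idx_chain I.
  by exists I; split=> //; exists u, u; split=> //; exact: eqlstp_refl.
have amalg J1 J2 : JJ J1 -> JJ J2 -> exists c, indisc_snoc A J1 c /\ indisc_snoc A J2 c.
  move=> h1 h2; apply: (@amalgamation Q I okI) => //.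
  - by move=> a; exact: lascar_ok_realizes.
  - exact: lascar_class_locally_ok.
  - exact: lascar_class_locally_ok.
rewrite lascar_eventual; split.
  exact: (eventual_complete real lascar_class_cat nonempty amalg).
apply: (eventual_does_not_fork real lascar_class_cat nonempty amalg).
by move=> g J; exact: lascar_class_strong.
Qed.

End LascarClass.

(** * The class of a special type *)

Section TypeClass.
Variables (Q : emtype s A) (I : eseq M K s).
Hypotheses (IQ : realizes_em I Q) (I_special : special A I).

Let JJ J := realizes_em J Q.
Let okI (a : idx I -> tup s) := eqtp A (flat a) (flat I).

Lemma type_class_automorphism g J : automorphism_over A g -> JJ J -> JJ (map_seq g J).
Proof.
move=> gA [iJ JQ]; split; first exact: indiscernible_map.
exact: (@realizes_automorphism A X s Q _ (ilt J) J g gA JQ).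
Qed.

Lemma type_class_cat J c : JJ J -> cont A J c -> JJ (cat_seq J c).
Proof.
move=> [iJ JQ] Jc; split; first exact/cont_indisc.
exact: (@realizes_cat_seq Q J c JQ Jc).
Qed.

Lemma type_ok_realizes a : okI a -> realizes Q (ilt I) a.
Proof.
move=> /eqtp_sym /(homogeneous_over A_small (@small_flat I)) [g gA hg].
have -> : a = (fun i x => g _ (I i x)).
  apply/funext => i; apply: functional_extensionality_dep => x; exact/esym/(hg (i, x)).
exact: (@realizes_automorphism A X s Q _ (ilt I) I g gA IQ.2).
Qed.

Lemma type_class_locally_ok J : JJ J -> locally_ok okI J.
Proof.
move=> [iJ JQ] n i iinc; have [u uinc] := idx_chain I.
have uinc' : increasing (ilt I) (fun k : 'I_n => u k) by move=> k l; exact: uinc.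
have e : eqtp A (flat (fun k : 'I_n => I (u k))) (flat (fun k => J (i k))).
  by move=> f; rewrite (IQ.2 n _ uinc') (JQ n _ iinc).
have sn : small K [set: 'I_n * X].
  by apply: small_prod => //; [exact: monster_lim|exact: small_ord].
have [g gA hg] := homogeneous_over A_small sn e.
exists (fun j x => g _ (I j x)), (fun k => u k); split=> //.
  exact: (automorphism_eqtp (flat I) gA).
by move=> k; apply: functional_extensionality_dep => x; exact: (hg (k, x)).
Qed.

Lemma type_eventual (C : set elt) :
  ev_type K Q C = (fun h : form_over s C => eventual JJ (sval h)).
Proof. by []. Qed.

Lemma special_type_eventual (C : set elt) :
  complete_type (ev_type K Q C) /\ ~ splits A (ev_type K Q C) /\
  ~ forks K A (ev_type K Q C).
Proof.
have real J : JJ J -> realizes Q (ilt J) J by case.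
have nonempty : exists J, JJ J by exists I.
have amalg J1 J2 : JJ J1 -> JJ J2 -> exists c, indisc_snoc A J1 c /\ indisc_snoc A J2 c.
  move=> h1 h2; apply: (@amalgamation Q I okI) => //.
  - exact: type_ok_realizes.
  - by case: I_special.
  - exact: type_class_locally_ok.
  - exact: type_class_locally_ok.
rewrite type_eventual; split; [|split].
- exact: (eventual_complete real type_class_cat nonempty amalg).
(* An automorphism over [A] taking [b] to [b'] fixes [c], so it carries one whole parameter tuple to
   the other. *)
- move=> [m [n [r [q [f [b [b' [c [Cb [Cb' [cA bb' /= neq]]]]]]]]]]].
  apply: neq; have [g gA gb] := homogeneous_over A_small (@small_ord m) bb'.
  rewrite -(eventual_automorphism real type_class_cat nonempty amalg _ _ gA); last first.
    by move=> J; exact: type_class_automorphism.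
  congr (eventual JJ (PForm f _)); apply: functional_extensionality_dep => i.
  by case: (fintype.split i) => j /=; [rewrite gb|rewrite (gA.2 _ (cA j))].
- apply: (eventual_does_not_fork real type_class_cat nonempty amalg).
  by move=> g J [gA _]; exact: type_class_automorphism.
Qed.

End TypeClass.
End Eventual.

End ModelTheory.

Theorem corollary2p25 (R : realType) (L : language R) (T : theory L)
  (T_complete : complete_theory T)
  (M : structure L) (M_T : models M T)
  (K : Type) (M_monster : monster M K) (T_dependent : dependent M K)
  (A : set (elt M)) (A_small : small K A)
  (X : Type) (X_small : small K [set: X]%classic) (s : X -> lsort L) :
  (forall I : eseq M K s, lascar_special A I ->
     forall C : set (elt M),
       complete_type (ev_lascar A I C) /\
       ~ forks K A (ev_lascar A I C)) /\
  (forall Q : emtype s A, special_type K Q ->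
     forall C : set (elt M),
       complete_type (ev_type K Q C) /\
       ~ splits A (ev_type K Q C) /\
       ~ forks K A (ev_type K Q C)).
Proof.
have [TL] := language_tame L; split=> [I I_special C|Q [I IQ I_special] C].
  exact: (lascar_special_eventual TL M_monster T_dependent A_small X_small I_special C).
exact: (special_type_eventual TL M_monster T_dependent A_small X_small IQ I_special C).
Qed.
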